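(* Let $G=(V,E)$ be a finite graph. If $G$ is a string graph, then the string obstruction $\mathfrak{o}^s_{G}$ vanishes.
   Context: **Graphs.** A graph $G=(V,E)$ is finite, with vertex set $V$ and edge set $E$, each edge being a set of exactly two vertices; $vw$ abbreviates $\{v,w\}$. When $G$ is the domain of a map, it denotes its geometric realization (a point for each vertex, a line segment for each edge, glued at endpoints), and for an edge $\alpha$, $f(\alpha)$ is the image of the corresponding (closed) segment. **String graphs.** $G=(V,E)$ is a string graph if there are sets $\gamma_v\subseteq\mathbb{R}^2$ ($v\in V$), each the image of a continuous map $[0,1]\to\mathbb{R}^2$, such that for any two vertices $v\ne w$: $\gamma_v\cap\gamma_w\neq\emptyset$ if and only if $vw\in E$. **Piecewise linear maps in general position.** A subdivision of $G$ is a graph $H$ with a homeomorphism $G\to H$ taking vertices of $G$ to vertices of $H$. A map $f:G\to\mathbb{R}^2$ is piecewise linear and in general position if there is a subdivision $H$ of $G$ such that the composition of $f$ with the inverse homeomorphism $H\to G$ is linear on each edge of $H$, takes no three vertices of $H$ to the same line, and no three distinct edges of $H$ have images passing through a common point that is not the image of a vertex. **Modified Van Kampen obstruction.** Let $P\subseteq E^2$ be a symmetric collection of pairs of disjoint edges (each $(\alpha,\beta)\in P$ satisfies $(\beta,\alpha)\in P$ and $\alpha\cap\beta=\emptyset$). For $f:G\to\mathbb{R}^2$ piecewise linear and in general position, define $o_f\in\mathbb{Z}_2^P$ by $o_f(\alpha,\beta)=|f(\alpha)\cap f(\beta)| \bmod 2$. For $u\in V$, $\omega\in E$ with $u\notin\omega$,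 define $\varphi_{\omega,u}\in\mathbb{Z}_2^P$ by $\varphi_{\omega,u}(\alpha,\beta)=1$ if ($\alpha=\omega$ and $u\in\beta$) or ($\beta=\omega$ and $u\in\alpha$), and $0$ otherwise. Let $\Phi$ be the set of all such $\varphi_{\omega,u}$. Two vectors of $\mathbb{Z}_2^P$ are equivalent if their difference lies in $\mathrm{span}_{\mathbb{Z}_2}(\Phi)$. The obstruction $\mathfrak{o}_G(P)$ is the equivalence class $[o_f]$ for any choice of $f:G\to\mathbb{R}^2$ piecewise linear and in general position (the class does not depend on the choice of $f$). It vanishes if $\mathfrak{o}_G(P)=[0]$, i.e. $o_f\in\mathrm{span}_{\mathbb{Z}_2}(\Phi)$. **String obstruction.** Let $P_s(G)=\{(\alpha,\beta)\in E^2 : vw\notin E \text{ for every } v\in\alpha,\ w\in\beta\}$ (these are pairs of disjoint edges). The string obstruction of $G$ is $\mathfrak{o}^s_G=\mathfrak{o}_G(P_s(G))$. *)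

(* Defs.v *)
From HB Require Import structures.
From mathcomp Require Import all_boot all_order all_algebra finmap.
From mathcomp Require Import all_classical all_reals all_analysis.
Import Order.TTheory GRing.Theory Num.Theory.
Import numFieldNormedType.Exports.

Set Implicit Arguments.
Unset Strict Implicit.
Unset Printing Implicit Defensive.

Local Open Scope ring_scope.
Local Open Scope classical_set_scope.

Record graph := Graph {
  vertex :> finType;
  edges : {set {set vertex}};
  edges_card : forall e, e \in edges -> #|e| = 2%N }.

Definition adj (G : graph) (v w : G) : bool := [set v; w]%SET \in edges G.

Definition curve (R : realType) (A : set (R * R)) : Prop :=
  exists2 c : R -> R * R,
    {within `[0, 1]%classic, continuous c} & A = c @` `[0, 1]%classic.

Definition string_graph (R : realType) (G : graph) : Prop :=
  exists2 gam : G -> set (R * R),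
    (forall v, curve (gam v)) &
    (forall v w, v != w -> (gam v `&` gam w !=set0 <-> adj v w)).

(* The geometric realization of [G] is the set of barycentric coordinate
   functions on the vertices whose support lies in a vertex or in an edge. *)
Definition bary (R : realType) (G : graph) := {ptws G -> R}.

Definition vpoint (R : realType) (G : graph) (v : G) : bary R G :=
  fun w => (w == v)%:R.

Definition cell (R : realType) (G : graph) (A : {set G}) : set (bary R G) :=
  [set x | [/\ forall v, 0 <= x v, \sum_v x v = 1 &
               forall v, v \notin A -> x v = 0]].

Definition realization (R : realType) (G : graph) : set (bary R G) :=
  [set x | (exists v, x = vpoint R v) \/
           (exists2 e, e \in edges G & cell e x)].

Definition inverse_homeo (T U : topologicalType) (A : set T) (B : set U)
    (h : T -> U) (k : U -> T) : Prop :=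
  [/\ forall x, A x -> B (h x) /\ k (h x) = x,
      forall y, B y -> A (k y) /\ h (k y) = y,
      {within A, continuous h} & {within B, continuous k}].

(* [h] makes [H] a subdivision of [G]; [k] is the inverse of [h]. *)
Definition subdivision (R : realType) (G H : graph)
    (h : bary R G -> bary R H) (k : bary R H -> bary R G) : Prop :=
  inverse_homeo (@realization R G) (@realization R H) h k /\
  forall v : G, exists w : H, h (vpoint R v) = vpoint R w.

Definition linear_on_edge (R : realType) (H : graph) (g : bary R H -> R * R)
    (e : {set H}) : Prop :=
  forall x, cell e x -> g x = \sum_(v in e) x v *: g (vpoint R v).

Definition collinear (R : realType) (p q r : R * R) : Prop :=
  exists a b c : R, (a, b) != (0, 0) /\
    forall s, [set p; q; r] s -> a * s.1 + b * s.2 = c.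

(* Maps on the geometric realization are represented by functions on all
   coordinate functions; only their values on [realization] matter. *)
Definition pl_general_position (R : realType) (G : graph)
    (f : bary R G -> R * R) : Prop :=
  exists (H : graph) (h : bary R G -> bary R H) (k : bary R H -> bary R G),
    subdivision h k /\
    let g := f \o k in
    [/\ forall e, e \in edges H -> linear_on_edge g e,
        forall u v w : H, u != v -> v != w -> u != w ->
          ~ collinear (g (vpoint R u)) (g (vpoint R v)) (g (vpoint R w)) &
        forall a b c, a \in edges H -> b \in edges H -> c \in edges H ->
          a != b -> b != c -> a != c ->
          forall p, (g @` cell a) p -> (g @` cell b) p -> (g @` cell c) p ->
          exists v : H, p = g (vpoint R v)].

Section Obstruction.
Variables (R : realType) (G : graph).

Definition pair_collection (P : {set {set G} * {set G}}) : Prop :=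
  forall a b, (a, b) \in P ->
    [/\ a \in edges G, b \in edges G, (b, a) \in P & a :&: b = finset.set0].

Variable P : {set {set G} * {set G}}.

Definition idx := {p : {set G} * {set G} | p \in P}.

Definition vec := {ffun idx -> ('F_2)^o}.

(* On infinite sets [fset_set] is empty, but [f a] and [f b] meet in finitely
   many points when [f] is in general position and [a], [b] are disjoint. *)
Definition crossing_vec (f : bary R G -> R * R) : vec :=
  [ffun p : idx => (#|` fset_set (f @` cell (val p).1 `&` f @` cell (val p).2)|)%:R].

Definition phi (w : {set G}) (u : G) : vec :=
  [ffun p : idx => (((val p).1 == w) && (u \in (val p).2)
           || ((val p).2 == w) && (u \in (val p).1))%:R].

Definition Phi : seq vec :=
  [seq phi x.1 x.2 | x <- enum [set x : {set G} * G |
                                 (x.1 \in edges G) && (x.2 \notin x.1)]%SET].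

Definition equiv_vec (x y : vec) : bool := x - y \in <<Phi>>%VS.

Definition class_of (y : vec) : set vec := [set x | equiv_vec x y].

(* The union of the classes of all admissible [f]; these classes coincide, so
   this is the common class, without a choice of [f] being singled out. In
   particular [obstruction = class_of 0] says that an admissible [f] exists and
   that every admissible [f] has its crossing vector in the span of [Phi]. *)
Definition obstruction : set vec :=
  [set x | exists2 f : bary R G -> R * R,
     pl_general_position f & class_of (crossing_vec f) x].

Definition obstruction_vanishes : Prop := obstruction = class_of 0.

End Obstruction.

Definition string_pairs (G : graph) : {set {set G} * {set G}} :=
  [set p | [&& p.1 \in edges G, p.2 \in edges G &
     [forall v in p.1, forall w in p.2, ~~ adj v w]]]%SET.

Lemma string_pairs_collection (G : graph) : pair_collection (string_pairs G).
Proof.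
move=> a b; rewrite !inE /= => /and3P[aE bE /forall_inP nadj].
have nadjP v w : v \in a -> w \in b -> ~~ adj v w.
  by move=> va wb; move/forall_inP: (nadj v va); apply.
split=> //.
  rewrite aE bE /=; apply/forall_inP => v vb; apply/forall_inP => w wa.
  by rewrite /adj finset.setUC; exact: nadjP.
apply/eqP; rewrite -finset.subset0; apply/fintype.subsetP => v; rewrite inE => /andP[va vb].
move/eqP/cards2P: (edges_card aE) => [x [y [_ axy]]].
have bxy : (x \in b) || (y \in b).
  by move: va vb; rewrite axy !inE => /orP[] /eqP -> ->; rewrite ?orbT.
case/orP: bxy => [xb|yb].
  have := nadjP y x; rewrite /adj finset.setUC -axy aE axy !inE eqxx orbT.
  by move/(_ isT xb).
have := nadjP x y; rewrite /adj -axy aE axy !inE eqxx.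
by move/(_ isT yb).
Qed.

Definition string_obstruction_vanishes (R : realType) (G : graph) : Prop :=
  obstruction_vanishes R (string_pairs G).

(* Main.v *)
Require Import Defs.
From mathcomp Require Import all_boot all_order all_algebra.
From mathcomp Require Import all_classical all_reals all_analysis.
From mathcomp Require Import finmap ring lra.
Import Order.TTheory GRing.Theory Num.Theory.
Import numFieldNormedType.Exports.

(** Any two drawings of a graph have equivalent crossing vectors, and a string
representation gives a drawing in which the edges of a string pair do not cross at
all.

Independence of the drawing rests on a formula for two segments [s] and [t], neither
of which contains an end point of the other.  Modulo 2, they cross as often as there
are end points of [s] above [t], plus end points of [t] above [s], plus pairs of an
end point of [s] and one of [t] in this horizontal order ([crossing_parity]).  Let the
edges [a] and [b] be drawn as polygonal arcs and sum over their segments.  The sums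
over end points telescope along the arcs, and there remain a sum over [u] in [a] of
terms A(b, u) plus a sum over [v] in [b] of terms A(a, v), which is a combination of
the generators [phi], and the number of pairs [u] in [a], [v] in [b] such that [u] lies
left of [v] ([crossings_order]).  The latter depends on the horizontal order of the
vertices only, and passing to another order again adds a combination of generators
([sym_finger]).  Hence the crossing parities of two polygonal drawings differ by an
element of the span of [Phi] ([crossings_invariant]).

A map in general position is such a drawing: its subdivision homeomorphism carries each
edge of [G] to a path in the subdivision ([subdivided_edge]), and general position makes
the number of common points of two arcs equal to the number of crossings of their
segments ([pl_drawing]).  For a string graph, follow the curves of the two ends of every
edge by short steps ([string_drawing]): the crossing parities of string pairs are 0, so
those of every map in general position lie in the span.  The class is formed over the
admissible maps, so there must also be one ([pl_general_position_exists]). *)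

Set Implicit Arguments.
Unset Strict Implicit.
Unset Printing Implicit Defensive.

Local Open Scope ring_scope.
Local Open Scope classical_set_scope.

(** * Finger moves *)

Lemma addF2 (x : 'F_2) : x + x = 0.
Proof. by rewrite addrr_pchar2 ?pchar_Fp. Qed.

Lemma natF2_addb (a b : bool) : (a (+) b)%:R = a%:R + b%:R :> 'F_2.
Proof. by case: a; case: b; rewrite ?addF2 ?addr0 ?add0r. Qed.

Section FingerMoves.
Variable G : graph.
Implicit Type A : {set G} -> G -> 'F_2.

(** The effect on the crossings of the pair [p] of moving, for every [w] and [u]
with [A w u = 1], the edge [w] once across the vertex [u]. *)
Definition finger A (p : {set G} * {set G}) : 'F_2 :=
  \sum_(u in p.1) A p.2 u + \sum_(u in p.2) A p.1 u.

Lemma pair_disjoint (P : {set {set G} * {set G}}) p u : pair_collection P ->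
  p \in P -> u \in p.1 -> u \notin p.2.
Proof.
case: p => a b hP /hP[_ _ _ /setP/(_ u)] /=.
by rewrite !inE => ab0 ua; move: ab0; rewrite ua /= => ->.
Qed.

(** [finger A] is the combination of the generators [phi w u] with coefficients
[A w u]; the two cases in the definition of [phi] exclude each other because the
edges of a pair are disjoint. *)
Lemma finger_span (P : {set {set G} * {set G}}) A : pair_collection P ->
  [ffun p : idx P => (finger A (val p) : ('F_2)^o)] \in <<Phi P>>%VS.
Proof.
move=> hP.
have -> : [ffun p : idx P => (finger A (val p) : ('F_2)^o)] =
  \sum_(x in [set x : {set G} * G | (x.1 \in edges G) && (x.2 \notin x.1)]%SET)
     (A x.1 x.2 *: phi P x.1 x.2 : vec P).
  apply/ffunP => p; rewrite ffunE sum_ffunE.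
  case: p => -[a b] /= pP; have [aE bE _ _] := hP _ _ pP.
  have disj u : u \in a -> u \notin b := fun ua => pair_disjoint hP pP ua.
  transitivity (\sum_(w in edges G) \sum_(u | u \notin w)
     ((if w == b then if u \in a then A w u else 0 else 0) +
      (if w == a then if u \in b then A w u else 0 else 0))); last first.
    rewrite pair_big_dep; apply: eq_big => [x|[w u] /= /andP[wE uw]].
      by rewrite inE.
    rewrite 2!ffunE /= [a == w]eq_sym [b == w]eq_sym.
    transitivity (A w u * ((w == a) && (u \in b) || (w == b) && (u \in a))%:R) => //.
    case: (eqVneq w a) => [wa|_]; case: (eqVneq w b) => [wb|_];
      rewrite /= ?orbF ?addr0 ?add0r ?mulr0 //;
      try by case: ifP; rewrite ?mulr1 ?mulr0.
    by rewrite -wa -wb (negbTE uw) addr0 mulr0.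
  rewrite /finger /=.
  under [RHS]eq_bigr do rewrite big_split.
  rewrite big_split /=; congr (_ + _).
    rewrite (bigD1 b) //= [X in _ + X]big1 ?addr0; last first.
      by move=> w /andP[_ /negbTE ->]; rewrite big1.
    rewrite eqxx -big_mkcondr /=; apply: eq_bigl => u.
    by apply/idP/andP => [ua|[]//]; rewrite disj.
  rewrite (bigD1 a) //= [X in _ + X]big1 ?addr0; last first.
    by move=> w /andP[_ /negbTE ->]; rewrite big1.
  rewrite eqxx -big_mkcondr /=; apply: eq_bigl => u.
  by apply/idP/andP => [ub|[]//]; split=> //; apply: contraTN ub => /disj.
apply: memv_suml => x xS; apply/memvZ/memv_span/map_f.
by rewrite mem_enum.
Qed.

(** A sum of a symmetric function over the pairs of end vertices is a finger
move: enumerate the vertices and let [A w v] collect the values [d u v] with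
[u] in [w] preceding [v], so that each unordered pair is counted once. *)
Lemma sym_finger (P : {set {set G} * {set G}}) (d : G -> G -> 'F_2) :
  pair_collection P ->
  (forall p u v, p \in P -> u \in p.1 -> v \in p.2 -> d u v = d v u) ->
  exists A, forall p, p \in P -> \sum_(u in p.1) \sum_(v in p.2) d u v = finger A p.
Proof.
move=> hP dsym.
pose lt (u v : G) := (enum_rank u < enum_rank v)%N.
exists (fun (w : {set G}) v => \sum_(u in w | lt u v) d u v) => -[a b] pP.
rewrite /finger /=.
have -> : \sum_(u in b) \sum_(v in a | lt v u) d v u =
          \sum_(u in a) \sum_(v in b | lt u v) d u v.
  rewrite (exchange_big_dep (mem a)) /= => [|i j _ /andP[] //].
  by apply: eq_bigr => u ua; apply: eq_bigl => v; rewrite ua.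
rewrite -big_split; apply: eq_bigr => u ua /=.
rewrite (bigID (lt^~ u)) /=; congr (_ + _).
  by apply: eq_bigr => v /andP[vb _]; exact: (dsym (a, b)).
apply: eq_bigl => v; case vb: (v \in b) => //=.
rewrite /lt -leqNgt leq_eqVlt; case: eqVneq => //= /val_inj/enum_rank_inj uv.
by have := pair_disjoint hP pP ua; rewrite /= uv vb.
Qed.

End FingerMoves.

(** * Crossings of two segments *)

Section Segments.
Variable R : realFieldType.
Implicit Types (z : R * R) (e s t : (R * R) * (R * R)) (x : R).

Definition seg e : set (R * R) :=
  [set z | exists a, [/\ 0 <= a <= 1, z.1 = (1 - a) * e.1.1 + a * e.2.1
                                    & z.2 = (1 - a) * e.1.2 + a * e.2.2]].

Definition meets s t : bool := `[< seg s `&` seg t !=set0 >].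

Definition flip e := (e.2, e.1).

Lemma seg_flip e : seg (flip e) = seg e.
Proof.
by apply/seteqP; split=> z [a [a01 z1 z2]]; exists (1 - a); split; rewrite ?z1 ?z2 /=; lra.
Qed.

Lemma seg_left e : seg e e.1.
Proof. by exists 0; split; lra. Qed.

Lemma seg_right e : seg e e.2.
Proof. by exists 1; split; lra. Qed.

Lemma meetsC s t : meets s t = meets t s.
Proof. by rewrite /meets setIC. Qed.

Definition height e x := e.1.2 + (x - e.1.1) * ((e.2.2 - e.1.2) / (e.2.1 - e.1.1)).

(** The exclusive or makes this symmetric in the end points, and additive: it
telescopes when the segments of a chain are summed modulo 2. *)
Definition straddles e x := (e.1.1 < x) (+) (e.2.1 < x).

Definition above z e := straddles e z.1 && (height e z.1 < z.2).

Lemma above_flip z e : above z (flip e) = above z e.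
Proof.
rewrite /above /straddles addbC /=; case: ltP => h1; case: ltP => h2 //=;
congr (_ < _); rewrite /height /=; field; lra.
Qed.

Lemma segP e z : e.1.1 < e.2.1 ->
  seg e z <-> e.1.1 <= z.1 <= e.2.1 /\ z.2 = height e z.1.
Proof.
move=> ee; have de : e.2.1 - e.1.1 != 0 by lra.
rewrite /height; split.
  move=> [a [/andP[a0 a1] z1 z2]]; split.
    have : 0 <= a * (e.2.1 - e.1.1) <= e.2.1 - e.1.1.
      by rewrite mulr_ge0 ?ler_piMl; lra.
    by rewrite z1 => /andP[h1 h2]; apply/andP; split; lra.
  by rewrite z1 z2; field.
move=> [/andP[z1 z2] z3]; exists ((z.1 - e.1.1) / (e.2.1 - e.1.1)); split.
- by rewrite divr_ge0 ?ler_pdivrMr ?mul1r; lra.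
- by field.
- by rewrite z3; field.
Qed.

Lemma sign_change_ratio (a b : R) : a * b <= 0 -> a != 0 ->
  a - b != 0 /\ 0 <= a / (a - b) <= 1.
Proof.
move=> ab a0; have [a_gt0|a_le0] := ltP 0 a.
  move: ab; rewrite pmulr_rle0 // => b0.
  by split; [lra | rewrite divr_ge0 ?ler_pdivrMr ?mul1r; lra].
have a_lt0 : a < 0 by rewrite lt_neqAle a0.
move: ab; rewrite nmulr_rle0 // => b0; split; first lra.
by rewrite -[a / _]mulrNN -invrN opprB divr_ge0 ?ler_pdivrMr ?mul1r; lra.
Qed.

(** Two graphs of affine functions over a common interval meet exactly when their
difference changes sign between the ends of the interval. *)
Lemma meets_overlap s t l u : s.1.1 < s.2.1 -> t.1.1 < t.2.1 -> l <= u ->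
  l = Num.max s.1.1 t.1.1 -> u = Num.min s.2.1 t.2.1 ->
  meets s t = ((height s l - height t l) * (height s u - height t u) <= 0).
Proof.
move=> ss tt lu lE uE.
have [ls lt] : s.1.1 <= l /\ t.1.1 <= l by rewrite lE; split; rewrite le_max lexx ?orbT.
have [us ut] : u <= s.2.1 /\ u <= t.2.1 by rewrite uE; split; rewrite ge_min lexx ?orbT.
apply/asboolP/idP => [[z [/(segP _ ss)[zs z2s] /(segP _ tt)[zt z2t]]]|].
  have zl : l <= z.1 by rewrite lE ge_max; lra.
  have zu : z.1 <= u by rewrite uE le_min; lra.
  move: z2s; rewrite z2t /height.
  set k := _ / _; set k' := _ / _; clearbody k k' => E.
  suff -> : (s.1.2 + (l - s.1.1) * k' - (t.1.2 + (l - t.1.1) * k)) *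
   (s.1.2 + (u - s.1.1) * k' - (t.1.2 + (u - t.1.1) * k)) =
   - (((z.1 - l) * (u - z.1)) * (k' - k) ^+ 2).
    by rewrite oppr_le0 mulr_ge0 ?sqr_ge0 ?mulr_ge0; lra.
  have -> : t.1.2 = s.1.2 + (z.1 - s.1.1) * k' - (z.1 - t.1.1) * k by lra.
  ring.
set a := _ - _; set b := _ - _ => ab.
(* the root divides the interval in the ratio of the end values *)
suff [x /andP[lx xu] hx] : exists2 x, l <= x <= u & height s x = height t x.
  by exists (x, height s x); split; apply/segP => //=; split => //; lra.
have [a0|a0] := eqVneq a 0.
  by exists l; [lra | apply/eqP; rewrite -subr_eq0 -/a a0].
have [dab a01] := sign_change_ratio ab a0.
exists (l + a / (a - b) * (u - l)).
  by case/andP: a01 => c0 c1; apply/andP; split; nra.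
have -> : a / (a - b) * (u - l) = a * (u - l) / (a - b) by ring.
apply/eqP; rewrite -subr_eq0; apply/eqP.
move: dab; rewrite /a /b /height.
set k := (_ / _); set k' := _ / (t.2.1 - _); clearbody k k' => dab.
by field.
Qed.

Lemma offseg s z : s.1.1 < s.2.1 -> ~ seg s z -> s.1.1 <= z.1 <= s.2.1 ->
  height s z.1 != z.2.
Proof. by move=> ss nz zs; apply/eqP => h; apply: nz; apply/segP. Qed.

Definition endpoints_off s t : Prop :=
  [/\ ~ seg t s.1, ~ seg t s.2, ~ seg s t.1 & ~ seg s t.2].

Definition ends_before s t :=
  (s.1.1 < t.1.1) (+) (s.1.1 < t.2.1) (+) (s.2.1 < t.1.1) (+) (s.2.1 < t.2.1).

Definition ends_above s t := above s.1 t (+) above s.2 t.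

Lemma mulr_le0_addb (a b : R) : a != 0 -> b != 0 -> (a * b <= 0) = (a < 0) (+) (b < 0).
Proof.
have [a0|a0|//] := ltgtP a 0 => _; have [b0|b0|//] := ltgtP b 0 => _ /=.
- by apply: lt_geF; rewrite nmulr_lgt0.
- by rewrite nmulr_rle0 ?ltW.
- by rewrite pmulr_rle0 ?ltW.
- by apply: lt_geF; rewrite pmulr_rgt0.
Qed.

(** Let [s] start left of [t].  If the horizontal extents overlap, then each end of
the overlap is an end point of [s] or of [t], and by [meets_overlap] the segments
meet iff the order of the heights differs at the two ends.  At an end point of
[s] that order is read off [above _ t]; at an end point of [t] it is the opposite
of [above _ s], and [ends_before] counts these sign corrections. *)
Let crossing_parity_ordered s t : s.1.1 < s.2.1 -> t.1.1 < t.2.1 -> s.1.1 < t.1.1 ->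
  s.2.1 != t.1.1 -> s.2.1 != t.2.1 -> endpoints_off s t ->
  meets s t = ends_above s t (+) ends_above t s (+) ends_before s t.
Proof.
move=> ss tt st qr qs [nst1 nst2 nts1 nts2].
have lsr : (t.1.1 < s.1.1) = false by apply: le_gtF; lra.
have lss : (t.2.1 < s.1.1) = false by apply: le_gtF; lra.
have gss : s.1.1 < t.2.1 by lra.
rewrite /ends_above /above /straddles /ends_before st lsr lss gss /=.
have [sr|sr|/eqP] := ltgtP s.2.1 t.1.1; last by rewrite (negbTE qr).
  have -> : s.2.1 < t.2.1 by lra.
  have -> : (t.2.1 < s.2.1) = false by apply: le_gtF; lra.
  apply/asboolP => -[z [/(segP _ ss)[/andP[_ z1] _] /(segP _ tt)[/andP[z2 _] _]]].
  by have := lt_le_trans sr (le_trans z2 z1); rewrite ltxx.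
have lE : t.1.1 = Num.max s.1.1 t.1.1 by apply/esym/max_idPr; lra.
have hr : height s t.1.1 != t.1.2 by apply: offseg => //; lra.
have htr : height t t.1.1 = t.1.2 by rewrite /height subrr mul0r addr0.
have [ts|ts|/eqP] := ltgtP s.2.1 t.2.1; last by rewrite (negbTE qs).
  have uE : s.2.1 = Num.min s.2.1 t.2.1 by apply/esym/min_idPl; lra.
  have hq : height t s.2.1 != s.2.2 by apply: offseg => //; lra.
  have hsq : height s s.2.1 = s.2.2 by rewrite /height; field; lra.
  rewrite (meets_overlap ss tt (ltW sr) lE uE) htr hsq.
  rewrite mulr_le0_addb ?subr_eq0 // ?[s.2.2 == _]eq_sym // !subr_lt0.
  by case: ltgtP hr => // hr _; case: ltgtP hq.
have uE : t.2.1 = Num.min s.2.1 t.2.1 by apply/esym/min_idPr; lra.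
have hs : height s t.2.1 != t.2.2 by apply: offseg => //; lra.
have hts : height t t.2.1 = t.2.2 by rewrite /height; field; lra.
rewrite (meets_overlap ss tt (ltW tt) lE uE) htr hts.
rewrite mulr_le0_addb ?subr_eq0 // !subr_lt0.
by case: ltgtP hr => // hr _; case: ltgtP hs.
Qed.

Lemma meets_flip s t : meets (flip s) t = meets s t.
Proof. by rewrite /meets seg_flip. Qed.

Definition abscissae_apart s t : Prop :=
  [/\ s.1.1 != t.1.1, s.1.1 != t.2.1, s.2.1 != t.1.1 & s.2.1 != t.2.1].

Definition crossing_formula s t :=
  meets s t = ends_above s t (+) ends_above t s (+) ends_before s t.

Let crossing_formulaC s t : abscissae_apart s t ->
  crossing_formula t s -> crossing_formula s t.
Proof.
rewrite /crossing_formula meetsC => -[d1 d2 d3 d4] ->.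
rewrite [ends_above t s (+) _]addbC; congr (_ (+) _); rewrite /ends_before.
have lt_neg x y : x != y -> (x < y) = ~~ (y < x) by case: ltgtP.
by rewrite !(lt_neg s.1.1) // !(lt_neg s.2.1) //; do 4!case: (_ < _).
Qed.

Let crossing_formula_flip s t : crossing_formula (flip s) t -> crossing_formula s t.
Proof.
rewrite /crossing_formula meets_flip => ->; congr (_ (+) _ (+) _).
- by rewrite /ends_above addbC.
- by rewrite /ends_above !above_flip.
- by rewrite /ends_before /=; do 4!case: (_ < _).
Qed.

(** The hypotheses on abscissae allow a segment to be degenerate, but not
vertical; a degenerate segment contributes 0 to both sides. *)
Lemma crossing_parity s t : (s.1.1 = s.2.1 -> s.1 = s.2) -> (t.1.1 = t.2.1 -> t.1 = t.2) ->
  abscissae_apart s t -> endpoints_off s t -> crossing_formula s t.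
Proof.
have offC s' t' : endpoints_off s' t' -> endpoints_off t' s' by move=> [].
have apartC s' t' : abscissae_apart s' t' -> abscissae_apart t' s'.
  by move=> []; split; rewrite eq_sym.
have degenerate s' t' : s'.1 = s'.2 -> endpoints_off s' t' -> crossing_formula s' t'.
  move=> ss [ns _ _ _]; rewrite /crossing_formula /ends_above /ends_before ss addbb.
  have -> : meets s' t' = false.
    apply/asboolP => -[z [[a [_ z1 z2]] tz]]; apply: ns.
    suff -> : s'.1 = z by [].
    case: z z1 z2 {tz} => z1 z2 /= -> ->; rewrite -ss.
    by case: s'.1 => x y /=; congr pair; ring.
  rewrite /above /straddles -ss addbb /=.
  by rewrite !addbb; do 2!case: (s'.1.1 < _).
have flip_std s' t' : (s'.1.1 = s'.2.1 -> s'.1 = s'.2) ->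
    abscissae_apart s' t' -> endpoints_off s' t' ->
    (forall s'', s''.1.1 < s''.2.1 -> abscissae_apart s'' t' -> endpoints_off s'' t' ->
       crossing_formula s'' t') -> crossing_formula s' t'.
  move=> sv [d1 d2 d3 d4] [n1 n2 n3 n4] H; have [ss|ss|/sv ss] := ltgtP s'.1.1 s'.2.1.
  - exact: H.
  - by apply/crossing_formula_flip/H => //; split; rewrite // seg_flip.
  - exact: degenerate.
move=> sv tv st cst; apply: (flip_std) => // {sv st cst} s' ss st cst.
apply: crossing_formulaC => //; apply: (flip_std) => //; [exact: apartC|exact: offC|].
move=> {tv st cst} t' tt [d1 d2 d3 d4] cts.
have [ts|ts|/eqP] := ltgtP t'.1.1 s'.1.1; last by rewrite (negbTE d1).
  exact: crossing_parity_ordered.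
apply: crossing_formulaC => //.
apply: crossing_parity_ordered => //; [by rewrite eq_sym|by rewrite eq_sym|exact: offC].
Qed.

End Segments.

(** * Polygonal drawings *)

Section Shear.
Variable R : realFieldType.
Implicit Types (z p q : R * R) (e s t : (R * R) * (R * R)) (m : R).

Definition shear m p : R * R := (p.1 + m * p.2, p.2).

Definition shear_seg m e := (shear m e.1, shear m e.2).

Lemma shearK m : cancel (shear m) (shear (- m)).
Proof. by case=> x y; rewrite /shear /=; congr pair; ring. Qed.

Lemma seg_shear m e z : seg (shear_seg m e) (shear m z) <-> seg e z.
Proof.
split=> -[a [a01 /= z1 z2]]; exists a; split=> //=; last by rewrite z1 z2; ring.
by apply: (addIr (m * z.2)); rewrite z1 z2; ring.
Qed.

Lemma meets_shear m s t : meets (shear_seg m s) (shear_seg m t) = meets s t.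
Proof.
apply/asboolP/asboolP => -[z [sz tz]]; last by exists (shear m z); split; apply/seg_shear.
exists (shear (- m) z); have : shear m (shear (- m) z) = z by rewrite -{1}[m]opprK shearK.
by split; apply/(seg_shear m); rewrite H.
Qed.

Lemma endpoints_off_shear m s t :
  endpoints_off s t -> endpoints_off (shear_seg m s) (shear_seg m t).
Proof. by case=> h1 h2 h3 h4; split=> /seg_shear. Qed.

Lemma notin_seq (l : seq R) : exists x, x \notin l.
Proof.
exists (1 + \sum_(y <- l) `|y|); apply/negP => xl; set x := 1 + _ in xl.
have : `|x| <= \sum_(y <- l) `|y|.
  by rewrite (big_rem _ xl) /= lerDl sumr_ge0.
by apply/negP; rewrite -ltNge (lt_le_trans _ (ler_norm _)) // /x ltrDr.
Qed.

(** A shear identifies the abscissae of two points of different heights for one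
value of [m] only. *)
Lemma generic_shear (l : seq (R * R)) :
  exists m, {in l &, forall p q, (shear m p).1 = (shear m q).1 -> p = q}.
Proof.
have [m ml] := notin_seq [seq (q.1 - p.1) / (p.2 - q.2) | p <- l, q <- l].
exists m => p q pl ql /= pq; have [e2|d2] := eqVneq p.2 q.2.
  by move: pq; rewrite e2 => /addIr; case: p q e2 {pl ql} => [? ?] [? ?] /= -> ->.
case/negP: ml; apply/allpairsP; exists (p, q); split=> //=.
have d : p.2 - q.2 != 0 by rewrite subr_eq0.
apply: (mulIf d); rewrite divfK //; lra.
Qed.

Lemma crossing_parity_shear m s t :
  {in [:: s.1; s.2; t.1; t.2] &, forall p q, (shear m p).1 = (shear m q).1 -> p = q} ->
  endpoints_off s t ->
  meets s t = ends_above (shear_seg m s) (shear_seg m t) (+)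
              ends_above (shear_seg m t) (shear_seg m s) (+)
              ends_before (shear_seg m s) (shear_seg m t).
Proof.
move=> minj st; rewrite -(meets_shear m).
have ne p q : p \in [:: s.1; s.2; t.1; t.2] -> q \in [:: s.1; s.2; t.1; t.2] ->
    p <> q -> (shear m p).1 != (shear m q).1.
  by move=> pl ql pq; apply/eqP => /(minj _ _ pl ql).
have [n1 n2 n3 n4] := st.
have [t1 t2] := (seg_left t, seg_right t).
apply: crossing_parity; last exact: endpoints_off_shear.
- by move=> /minj E; rewrite /= E // !inE eqxx ?orbT.
- by move=> /minj E; rewrite /= E // !inE eqxx ?orbT.
- by split; apply: ne; rewrite ?inE ?eqxx ?orbT // => E;
    [apply: n1|apply: n1|apply: n2|apply: n2]; rewrite E.
Qed.

End Shear.

Section Drawings.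
Variables (R : realFieldType) (G : graph) (P : {set {set G} * {set G}}).

(** The vertices go to the points [pt] and each edge [w] to a polygonal arc, given
by the list [ch w] of its segments.  That this list joins the ends of [w] is
expressed modulo 2, by duality: for every function [F] on the plane, the sum of
[F] over the end points of the segments is its sum over the ends of [w].  Arcs
and vertices are constrained only for the pairs of edges in [P]. *)
Record drawing (pt : G -> R * R) (ch : {set G} -> seq ((R * R) * (R * R))) : Prop :=
  Drawing {
  drawing_ends : forall w, w \in edges G -> forall F : R * R -> 'F_2,
    \sum_(e <- ch w) (F e.1 + F e.2) = \sum_(u in w) F (pt u);
  drawing_off : forall p s t, p \in P -> s \in ch p.1 -> t \in ch p.2 ->
    endpoints_off s t;
  drawing_pt : forall p u v, p \in P -> u \in p.1 -> v \in p.2 -> pt u != pt v }.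

Definition crossings (ch : {set G} -> seq ((R * R) * (R * R)))
    (p : {set G} * {set G}) : 'F_2 :=
  \sum_(s <- ch p.1) \sum_(t <- ch p.2) (meets s t)%:R.

(** Sum [crossing_parity] over all pairs of segments, in coordinates where distinct
points have distinct abscissae.  By [drawing_ends] each sum over the end points of
the segments of an arc reduces to the ends of the edge: the terms with [above]
become a finger move, and what remains only sees the order of the vertices. *)
Lemma crossings_order pt ch : pair_collection P -> drawing pt ch ->
  exists (A : {set G} -> G -> 'F_2) (lt : rel G),
    (forall p u v, p \in P -> u \in p.1 -> v \in p.2 -> lt u v = ~~ lt v u) /\
    forall p, p \in P ->
      crossings ch p = finger A p + \sum_(u in p.1) \sum_(v in p.2) (lt u v)%:R.
Proof.
move=> hP [ends off ptne].
pose l := [seq pt u | u <- enum G] ++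
  [seq e.1 | w <- enum (edges G), e <- ch w] ++ [seq e.2 | w <- enum (edges G), e <- ch w].
have [m minj] := generic_shear l.
have ptl u : pt u \in l by rewrite mem_cat map_f ?mem_enum.
have chl w e : w \in edges G -> e \in ch w -> (e.1 \in l) /\ (e.2 \in l).
  by move=> wE we; rewrite !mem_cat; split; apply/or3P; [apply: Or32|apply: Or33];
    apply/allpairsPdep; exists w, e; rewrite mem_enum.
pose X (p : R * R) : R := (shear m p).1.
(* the parity of the number of segments of [w] below [u] *)
exists (fun w u => \sum_(t <- ch w) (above (shear m (pt u)) (shear_seg m t))%:R),
       (fun u v => X (pt u) < X (pt v)); split.
  move=> p u v pP up vp; have := ptne _ _ _ pP up vp.
  case: ltgtP => // /minj E; rewrite E ?eqxx //.
case=> a b pP; have [aE bE _ _] := hP _ _ pP.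
rewrite /crossings /=.
pose ab z t : 'F_2 := (above (shear m z) (shear_seg m t))%:R.
pose lt (z z' : R * R) : 'F_2 := (X z < X z')%R%:R.
transitivity (\sum_(s <- ch a) \sum_(t <- ch b)
   ((ab s.1 t + ab s.2 t) + (ab t.1 s + ab t.2 s) +
    ((lt s.1 t.1 + lt s.2 t.1) + (lt s.1 t.2 + lt s.2 t.2)))).
  apply: eq_big_seq => s sa; apply: eq_big_seq => t tb.
  have [[s1 s2] [t1 t2]] := (chl _ _ aE sa, chl _ _ bE tb).
  rewrite (@crossing_parity_shear _ m); first 1 last.
  - move=> p q; rewrite !inE => hp hq; apply: minj.
      by case/or4P: hp => /eqP ->.
    by case/or4P: hq => /eqP ->.
  - exact: off pP sa tb.
  by rewrite /ends_above /ends_before !natF2_addb /ab /lt /X /=; ring.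
under [LHS]eq_bigr do rewrite big_split big_split /=.
rewrite big_split /= big_split /finger /=; congr (_ + _ + _).
- rewrite exchange_big [RHS]exchange_big /=; apply: eq_bigr => t _.
  exact: (ends a aE (ab^~ t)).
- rewrite [RHS]exchange_big /=; apply: eq_bigr => s _.
  exact: (ends b bE (ab^~ s)).
- transitivity (\sum_(t <- ch b) (\sum_(u in a) lt (pt u) t.1 +
                                   \sum_(u in a) lt (pt u) t.2)).
    rewrite exchange_big /=; apply: eq_bigr => t _.
    by rewrite big_split (ends a aE (lt^~ t.1)) (ends a aE (lt^~ t.2)).
  rewrite (ends b bE (fun z => \sum_(u in a) lt (pt u) z)).
  by rewrite exchange_big.
Qed.

(** Two orders of the vertices differ by a function symmetric on the pairs that
occur, since reversing a pair flips both orders; [sym_finger] applies. *)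
Lemma crossings_invariant pt ch pt' ch' : pair_collection P ->
  drawing pt ch -> drawing pt' ch' ->
  exists A, forall p, p \in P -> crossings ch p = crossings ch' p + finger A p.
Proof.
move=> hP /(crossings_order hP)[A [lt [ltP cr]]] /(crossings_order hP)[A' [lt' [ltP' cr']]].
have [p u v pP ua vb|B BE] := @sym_finger G P (fun u v => (lt u v)%:R + (lt' u v)%:R) hP.
  by rewrite (ltP _ _ _ pP ua vb) (ltP' _ _ _ pP ua vb) -!natF2_addb addNb addbN negbK.
exists (fun w u => A w u + A' w u + B w u) => p pP.
rewrite cr // cr' //.
have -> : finger (fun w u => A w u + A' w u + B w u) p =
          finger A p + finger A' p + finger B p.
  by rewrite /finger !big_split /=; ring.
rewrite -BE //.
have -> : \sum_(u in p.1) \sum_(v in p.2) ((lt u v)%:R + (lt' u v)%:R) =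
  \sum_(u in p.1) \sum_(v in p.2) (lt u v)%:R +
  \sum_(u in p.1) \sum_(v in p.2) (lt' u v)%:R :> 'F_2.
  by rewrite -big_split; apply: eq_bigr => u _; rewrite -big_split.
have F (x y x' y' : 'F_2) : x + y = (x' + y') + (x + x' + (y + y')).
  have -> : (x' + y') + (x + x' + (y + y')) = x + y + ((x' + x') + (y' + y')) by ring.
  by rewrite !addF2 !addr0.
exact: F.
Qed.

End Drawings.

(** * Arcs in a graph are vertex paths *)

Section Links.
Variable T : Type.

Definition links (x : T) (s : seq T) : seq (T * T) := zip (x :: s) s.

Lemma sum_links (F : T -> 'F_2) x s :
  \sum_(e <- links x s) (F e.1 + F e.2) = F x + F (last x s).
Proof.
elim: s x => [|y s IH] x /=; first by rewrite big_nil addF2.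
by rewrite big_cons IH /= addrA -[_ + F y + F y]addrA addF2 addr0.
Qed.

End Links.

Lemma links_split (T : eqType) (x : T) s e : e \in links x s ->
  exists l1 l2, x :: s = l1 ++ e.1 :: e.2 :: l2.
Proof.
elim: s x => [|y s IH] x //=; rewrite inE => /orP[/eqP -> /=|/IH[l1 [l2 E]]].
  by exists [::], s.
by exists (x :: l1), l2; rewrite E.
Qed.

Section GraphPath.
Variables (R : realType) (H : graph).
Implicit Types (u v w : H) (e : {set H}) (y : bary R H).

Lemma closed_itv (S : set R) a b t : a < b -> closed S ->
  (forall t, a < t < b -> S t) -> a <= t <= b -> S t.
Proof.
move=> ab clS HS /andP[at_ tb]; apply: clS => B /nbhs_ballP[e /= e0 Be].
(* move from [t] towards the midpoint by a fraction [d] of the distance *)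
pose m := (a + b) / 2; pose d := Num.min 1 (e / (b - a)).
have ba : 0 < b - a by lra.
have d0 : 0 < d by rewrite lt_min ltr01 divr_gt0.
have [d1 de] : d <= 1 /\ d * (b - a) <= e.
  by rewrite -ler_pdivlMr // !ge_min !lexx orbT.
exists (t + d * (m - t)); split.
  apply: HS; have -> : t + d * (m - t) = a + ((1 - d) * (t - a) + d * ((b - a) / 2)).
    by rewrite /m; field.
  have h1 : 0 <= (1 - d) * (t - a) by rewrite mulr_ge0; lra.
  have h2 : 0 < d * ((b - a) / 2) by rewrite mulr_gt0; lra.
  have h3 : (1 - d) * (t - a) <= (1 - d) * (b - a) by rewrite ler_wpM2l; lra.
  by apply/andP; split; lra.
apply: Be; rewrite /ball /= opprD addrA subrr sub0r normrN normrM gtr0_norm //.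
apply: (@le_lt_trans _ _ (d * ((b - a) / 2))); last by have := mulr_gt0 d0 ba; lra.
apply: ler_wpM2l; first exact: ltW.
by rewrite ler_norml /m; apply/andP; split; lra.
Qed.

Lemma vpoint_inj : injective (@vpoint R H).
Proof.
move=> v w /(congr1 (fun x : bary R H => x v)); rewrite /vpoint eqxx.
by case: eqVneq => // _ /eqP; rewrite oner_eq0.
Qed.

Lemma cell_vpoint e v : cell e (vpoint R v) -> v \in e.
Proof.
by case=> _ _ he; apply: contraT => /he /eqP; rewrite /vpoint eqxx oner_eq0.
Qed.

Lemma vpoint_cell e v : v \in e -> cell e (vpoint R v).
Proof.
move=> ve; split=> [w||w]; rewrite /vpoint; first by rewrite ler0n.
  by rewrite (bigD1 v) //= eqxx big1 ?addr0 // => w /negbTE ->.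
by case: eqVneq => // ->; rewrite ve.
Qed.

Lemma cell_sum e y : cell e y -> \sum_(v in e) y v = 1.
Proof.
case=> _ <- he; rewrite [RHS](bigID (mem e)) /= [X in _ = _ + X]big1 ?addr0 // => v.
Qed.

Lemma cell_edge_sum u v y : u != v -> cell [set u; v]%SET y -> y u + y v = 1.
Proof. by move=> uv /cell_sum; rewrite big_setU1 ?inE // big_set1. Qed.

Lemma realization_ge0 y v : realization y -> 0 <= y v.
Proof. by case=> [[w ->]|[e _ []]//]; rewrite /vpoint ler0n. Qed.

Lemma realization_sum y : realization y -> \sum_v y v = 1.
Proof. by case=> [[w ->]|[e _ []]//]; have [] := @vpoint_cell [set w]%SET w (set11 w). Qed.

Lemma vpoint_realization v : realization (vpoint R v).
Proof. by left; exists v. Qed.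

Lemma cell_realization e y : e \in edges H -> cell e y -> realization y.
Proof. by move=> eE ye; right; exists e. Qed.

Lemma realization_cell e y : realization y -> \sum_(v in e) y v = 1 -> cell e y.
Proof.
move=> yH ye; split=> [v||v ve]; [exact: realization_ge0|exact: realization_sum|].
have y0 w : 0 <= y w by exact: realization_ge0.
have := realization_sum yH; rewrite (bigID (mem e)) /= ye -[RHS]addr0 => /addrI/eqP.
by rewrite psumr_eq0 // => /allP/(_ v (mem_index_enum _)) /implyP/(_ ve)/eqP.
Qed.

Lemma edge_ends e : e \in edges H -> exists v w, v != w /\ e = [set v; w]%SET.
Proof. by move=> /edges_card/eqP/cards2P[v [w [vw ->]]]; exists v, w. Qed.

Lemma edge_eq e u v : e \in edges H -> u != v -> u \in e -> v \in e -> e = [set u; v]%SET.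
Proof.
move=> /edges_card e2 uv ue ve; apply/eqP; rewrite eq_sym eqEcard e2 cards2 uv /= andbT.
by apply/fintype.subsetP => w; rewrite !inE => /orP[] /eqP ->.
Qed.

Lemma cell_interior e y v : e \in edges H -> cell e y -> ~ (exists w, y = vpoint R w) ->
  v \in e -> 0 < y v.
Proof.
move=> eE ye ny ve; have [y0 _ he] := ye; rewrite lt_neqAle y0 andbT eq_sym.
apply/eqP => yv; apply: ny; have [a [b [ab eE']]] := edge_ends eE.
have [w [wv E]] : exists w, w != v /\ e = [set v; w]%SET.
  move: ve; rewrite eE' !inE => /orP[] /eqP ->; first by exists b; rewrite eq_sym.
  by exists a; rewrite finset.setUC.
exists w; apply/funext => u; rewrite /vpoint; case: eqVneq => [->|uw].
  have vw : v != w by rewrite eq_sym.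
  by have := ye; rewrite E => /(cell_edge_sum vw); rewrite yv add0r.
have [->//|uv] := eqVneq u v.
by apply: he; rewrite E !inE negb_or uv.
Qed.

Section Consecutive.
Variables (c : R -> bary R H) (a b : R) (u v : H).
Hypotheses (cc : forall w, continuous (fun t => c t w)) (cH : forall t, realization (c t)).
Hypotheses (ab : a < b) (ca : c a = vpoint R u) (cb : c b = vpoint R v) (uv : u != v).
Hypothesis inner : forall t, a < t < b -> ~ exists w, c t = vpoint R w.

Let in_edge t : a < t < b -> exists2 e, e \in edges H & cell e (c t).
Proof. by move=> /inner nt; case: (cH t). Qed.

(** Between two consecutive vertices the arc stays in one edge [e]: among the points
that are not vertices those of [e] are the ones where both coordinates at the ends
of [e] are positive, an open condition, and also the ones where these coordinates
add up to 1, a closed condition; and an interval is connected. *)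
Lemma consecutive_edge : [set u; v]%SET \in edges H /\
  forall t, a <= t <= b -> cell [set u; v]%SET (c t).
Proof.
have mid : a < (a + b) / 2 < b by have := ab; lra.
have [e eE et0] := in_edge mid.
have [w1 [w2 [w12 eE']]] := edge_ends eE.
have sumE t : \sum_(w in e) c t w = c t w1 + c t w2.
  by rewrite eE' big_setU1 ?inE // big_set1.
have csum : continuous (fun t => c t w1 + c t w2).
  by move=> t; apply: cvgD; exact: cc.
have clS : closed [set t | c t w1 + c t w2 = 1].
  apply: (@closed_comp _ _ (fun t => c t w1 + c t w2) [set x | x = 1]) => [t _|].
    exact: csum.
  exact: closed_eq.
have inside : forall t, a < t < b -> cell e (c t).
  have := @connected_intervalP R `]a, b[%classic; case=> _.
  move=> /(_ (@interval_is_interval _ _)) conn.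
  have : [set t | a < t < b /\ cell e (c t)] = `]a, b[%classic.
    apply: conn.
    - by exists ((a + b) / 2).
    - exists ([set t | 0 < c t w1] `&` [set t | 0 < c t w2]).
        have pos w : open [set t | 0 < c t w].
          apply: (@open_comp _ _ (fun t => c t w) [set x | 0 < x]) => [t _|]; first exact: cc.
          exact: open_gt.
        exact: openI.
      apply/seteqP; split=> t /=; rewrite in_itv /=.
        move=> [tab te]; split=> //; have nt := inner tab.
        by split; apply: (cell_interior eE te nt); rewrite eE' !inE eqxx ?orbT.
      move=> [tab [t1 t2]]; split=> //; have [e' eE2 te'] := in_edge tab.
      have [_ _ he'] := te'.
      have we' w : 0 < c t w -> w \in e'.
        by move=> tw; apply: contraT => /he' E; rewrite E ltxx in tw.
      by rewrite eE' -(edge_eq eE2 w12 (we' _ t1) (we' _ t2)).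
    - exists [set t | c t w1 + c t w2 = 1] => //.
      apply/seteqP; split=> t /=; rewrite in_itv /=.
        by move=> [tab te]; split=> //; rewrite -sumE; exact: cell_sum.
      by move=> [tab te]; split=> //; apply: realization_cell; rewrite // sumE.
  by move=> E t tab; have : `]a, b[%classic t by []; rewrite -E => -[].
have all_in t : a <= t <= b -> cell e (c t).
  move=> tab; apply: realization_cell; first exact: cH.
  rewrite sumE; apply: (closed_itv ab clS) tab => s /inside se.
  by rewrite /= -sumE; exact: cell_sum.
have ue : u \in e by apply: cell_vpoint; rewrite -ca; apply: all_in; rewrite lexx ltW.
have ve : v \in e by apply: cell_vpoint; rewrite -cb; apply: all_in; rewrite lexx ltW.
by rewrite -(edge_eq eE uv ue ve).
Qed.

(** By the intermediate value theorem for the coordinate at [u], which falls from 1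
to 0 along the arc. *)
Lemma consecutive_onto y : cell [set u; v]%SET y -> exists2 t, a <= t <= b & c t = y.
Proof.
move=> yc; have [y0 _ yout] := yc.
have ysum := cell_edge_sum uv yc.
have [||t] := @IVT R (fun t => c t u) a b (y u) (ltW ab).
- by apply: continuous_subspaceT; exact: cc.
- rewrite ca cb /vpoint eqxx (negbTE uv) /=.
  have [y0u y0v] := (y0 u, y0 v).
  by rewrite ge_min le_max; apply/andP; split; apply/orP; [right|left]; lra.
rewrite in_itv /= => tab tu; exists t => //.
have tc := consecutive_edge.2 t tab; have [_ _ tout] := tc.
have tsum := cell_edge_sum uv tc.
apply/funext => w; have [->//|wu] := eqVneq w u.
have [->|wv] := eqVneq w v; first lra.
by rewrite tout ?yout // !inE negb_or wu.
Qed.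

End Consecutive.

End GraphPath.

Lemma links_cover (R : realType) (T : eqType) (f : T -> R) x s t : s != [::] ->
  f x <= t <= f (last x s) -> exists2 e, e \in links x s & f e.1 <= t <= f e.2.
Proof.
elim: s x => [|y s IH] x //= _ /andP[xt tl].
have [ty|yt] := leP t (f y); first by exists (x, y); rewrite ?inE ?eqxx //= xt.
have [||e es te] := IH y.
- by case: s {IH} tl => //= tl; have := lt_le_trans yt tl; rewrite ltxx.
- by rewrite ltW.
- by exists e => //; rewrite inE es orbT.
Qed.

(** An injective arc between two vertices of [H] meets every vertex at most once.
List the vertices that it meets by increasing time: consecutive ones are joined by
an edge, which the arc covers in between. *)
Lemma graph_path (R : realType) (H : graph) (c : R -> bary R H) (a b : H) :
  (forall w, continuous (fun t => c t w)) -> (forall t, realization (c t)) ->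
  (forall s t, 0 <= s <= 1 -> 0 <= t <= 1 -> c s = c t -> s = t) ->
  c 0 = vpoint R a -> c 1 = vpoint R b ->
  exists s : seq H, [/\ uniq (a :: s), last a s = b,
    forall e, e \in links a s -> [set e.1; e.2]%SET \in edges H &
    forall y, (exists2 t, 0 <= t <= 1 & c t = y) <->
              exists2 e, e \in links a s & cell [set e.1; e.2]%SET y].
Proof.
move=> cc cH cinj c0 c1.
pose hit w t := 0 <= t <= 1 /\ c t = vpoint R w.
pose K w : bool := `[< exists t, hit w t >].
(* the only time at which the arc is at [w] *)
pose tau w : R := xget 0 (hit w).
have tauP w : K w -> hit w (tau w) by move=> /asboolP; exact: xgetPex.
have tauE w t : hit w t -> K w /\ tau w = t.
  move=> wt; have Kw : K w by apply/asboolP; exists t.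
  have [[t1 t2] [s1 s2]] := (wt, tauP _ Kw).
  by split => //; apply: cinj; rewrite ?s2.
have tau_inj : {in K &, injective tau}.
  by move=> v w /tauP[_ v2] /tauP[_ w2] vw; apply: (@vpoint_inj R); rewrite -v2 -w2 vw.
have [Ka taua] : K a /\ tau a = 0 by apply: tauE; split; [lra|].
have [Kb taub] : K b /\ tau b = 1 by apply: tauE; split; [lra|].
pose l := sort (fun v w => tau v <= tau w) (enum K).
have lK w : w \in l = K w by rewrite mem_sort mem_enum.
have lu : uniq l by rewrite sort_uniq enum_uniq.
have lsort : pairwise (fun v w => tau v < tau w) l.
  have : pairwise (fun v w => tau v <= tau w) l.
    rewrite -sorted_pairwise; first by apply: sort_sorted => v w; exact: le_total.
    by move=> x y z; exact: le_trans.
  move: lu (fun w wl => etrans (esym (lK w)) wl : K w).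
  elim: l {lK} => //= v l IH /andP[vl lu] lK /andP[vall lp].
  rewrite IH ?andbT // => [|w wl]; last by apply: lK; rewrite inE wl orbT.
  apply/allP => w wl; have vw := allP vall w wl.
  rewrite lt_neqAle vw andbT; apply: contraNN vl => /eqP/tau_inj -> //; apply: lK.
    by rewrite mem_head.
  by rewrite inE wl orbT.
case El : l => [|a' s].
  by have := lK a; rewrite El Ka.
have aa : a' = a.
  have Ka' : K a' by rewrite -lK El mem_head.
  have := lsort; rewrite El /= => /andP[/allP hall _].
  have : a \in a' :: s by rewrite -El lK.
  rewrite inE => /orP[/eqP ->//|/hall]; rewrite taua.
  by have [/andP[h _] _] := tauP _ Ka'; rewrite ltNge h.
subst a'.
have lastb : last a s = b.
  have Kl : K (last a s) by rewrite -lK El mem_last.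
  have : b \in a :: s by rewrite -El lK.
  have := lsort; rewrite El; case/lastP: s {El} Kl => [|s z] Kl.
    by move=> _; rewrite inE /= => /eqP.
  rewrite last_rcons -!rcons_cons pairwise_rcons mem_rcons inE => /andP[/allP hall _].
  move=> /orP[/eqP//|/hall]; rewrite taub.
  rewrite last_rcons in Kl.
  by have [/andP[_ h] _] := tauP _ Kl; rewrite ltNge h.
have cons e : e \in links a s -> [/\ K e.1, K e.2, tau e.1 < tau e.2 &
    forall t, tau e.1 < t < tau e.2 -> ~ exists w, c t = vpoint R w].
  move=> /links_split[l1 [l2]]; rewrite -El => E.
  have [K1 K2] : K e.1 /\ K e.2 by rewrite -!lK E !mem_cat !inE !eqxx !orbT.
  have := lsort; rewrite E pairwise_cat /=.
  move=> /and3P[/allrelP h1 _ /and3P[/andP[h2 _] /allP h3 _]].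
  split=> // t /andP[t1 t2] [w cw].
  have [/andP[p1 _] _] := tauP _ K1; have [/andP[_ p2] _] := tauP _ K2.
  have [Kw tw] : K w /\ tau w = t by apply: tauE; split => //; lra.
  have : w \in l by rewrite lK.
  rewrite E mem_cat => /orP[wl|].
    by have := h1 w e.1 wl; rewrite mem_head tw => /(_ isT); lra.
  rewrite !inE => /or3P[/eqP we|/eqP we|/h3]; rewrite -?we ?tw; last by lra.
    by move: t1; rewrite -we tw ltxx.
  by move: t2; rewrite -we tw ltxx.
exists s; split=> //.
- by rewrite -El.
- move=> e /cons[K1 K2 h12 h]; have [[_ e1] [_ e2]] := (tauP _ K1, tauP _ K2).
  have e12 : e.1 != e.2 by apply: contraTneq h12 => ->; rewrite ltxx.
  by have [] := consecutive_edge cc cH h12 e1 e2 e12 h.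
- move=> y; split=> [[t t01 <-]|[e /cons[K1 K2 h12 h]] ye].
    have s0 : s != [::].
      apply/eqP => s0; move: taub; rewrite -lastb s0 /= taua.
      by move/esym/eqP; rewrite oner_eq0.
    have [|e es te] := @links_cover R H tau a s t s0; first by rewrite lastb taua taub.
    have [K1 K2 h12 h] := cons e es.
    have [[_ e1] [_ e2]] := (tauP _ K1, tauP _ K2).
    have e12 : e.1 != e.2 by apply: contraTneq h12 => ->; rewrite ltxx.
    by exists e => //; apply: (consecutive_edge cc cH h12 e1 e2 e12 h).2.
  have [[p1 e1] [p2 e2]] := (tauP _ K1, tauP _ K2).
  have e12 : e.1 != e.2 by apply: contraTneq h12 => ->; rewrite ltxx.
  have [t t12 cy] := consecutive_onto cc cH h12 e1 e2 e12 h ye.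
  exists t => //; lra.
Qed.

(** * Edges of a subdivided graph *)

Lemma cvg_bary (R : realType) (G : graph) (F : set_system (bary R G)) (x : bary R G) :
  Filter F -> (forall v, (fun y : bary R G => y v) @ F --> x v) -> F --> x.
Proof.
move=> FF Fx; apply/cvg_sup => i.
move=> U; have /= -> := @nbhsE (initial_topology (@proj G (fun=> R : topologicalType) i)) x.
case=> B [[C oC <- Cx]] /filterS; apply.
by apply: (Fx i); exact: open_nbhs_nbhs.
Qed.

Section EdgePoint.
Variables (R : realType) (G : graph).

Definition edge_point (u v : G) (t : R) : bary R G :=
  fun w => (1 - t) * (w == u)%:R + t * (w == v)%:R.

Lemma edge_point_cell u v t : u != v -> 0 <= t <= 1 ->
  cell [set u; v]%SET (edge_point u v t).
Proof.
move=> uv /andP[t0 t1]; split=> [w||w].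
- by rewrite addr_ge0 ?mulr_ge0 ?ler0n; lra.
- rewrite big_split -!mulr_sumr /=.
  have S z : \sum_w (w == z)%:R = 1 :> R := realization_sum (vpoint_realization R z).
  by rewrite !S; lra.
- by rewrite !inE negb_or /edge_point => /andP[/negbTE -> /negbTE ->] /=; lra.
Qed.

Lemma cell_edge_point u v x : u != v -> cell [set u; v]%SET x ->
  0 <= x v <= 1 /\ x = edge_point u v (x v).
Proof.
move=> uv xc; have [x0 _ xout] := xc; have xs := cell_edge_sum uv xc.
have [xu0 xv0] := (x0 u, x0 v); split; first lra.
apply/funext => w; rewrite /edge_point; have [->|wu] := eqVneq w u.
  by rewrite (negbTE uv) /=; lra.
have [->|wv] := eqVneq w v; first by rewrite /=; lra.
by rewrite xout ?inE ?negb_or ?wu //=; lra.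
Qed.

End EdgePoint.

Section Subdivision.
Variables (R : realType) (G H : graph).
Variables (h : bary R G -> bary R H) (k : bary R H -> bary R G).
Hypothesis hk : subdivision h k.

Lemma subdivision_inj x y : realization x -> realization y -> h x = h y -> x = y.
Proof. by case: hk => -[hx _ _ _] _ /hx[_ {2}<-] /hx[_ {2}<-] ->. Qed.

(** Retracts the line onto the unit interval, so that an edge of [G] can be
parametrized by a function continuous on all of [R]. *)
Definition clamp (t : R) := Num.max 0 (Num.min 1 t).

Lemma clampP t : 0 <= clamp t <= 1.
Proof. by rewrite /clamp le_max lexx /= ge_max ler01 ge_min lexx. Qed.

Lemma clamp_id t : 0 <= t <= 1 -> clamp t = t.
Proof. by case/andP=> t0 t1; rewrite /clamp; rewrite (min_idPr t1) (max_idPr t0). Qed.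

Lemma clamp_continuous : continuous clamp.
Proof.
move=> t; apply: continuous_max; first exact: cvg_cst.
by apply: continuous_min; [exact: cvg_cst|exact: cvg_id].
Qed.

Lemma subdivided_arc_continuous u v w : u != v -> [set u; v]%SET \in edges G ->
  continuous (fun t => h (edge_point u v (clamp t)) w).
Proof.
move=> uv uvE t; have [[_ _ hc _] _] := hk.
pose A : set (bary R G) := @realization R G.
have rt s : A (edge_point u v (clamp s)).
  by apply: (cell_realization uvE); exact: edge_point_cell uv (clampP s).
have epc : (fun s => edge_point u v (clamp s)) @ t -->
    (edge_point u v (clamp t) : bary R G).
  apply: cvg_bary => [|z]; first exact: fmap_filter.
  suff : (fun s => (1 - clamp s) * (z == u)%:R + clamp s * (z == v)%:R) @ t -->
      (1 - clamp t) * (z == u)%:R + clamp t * (z == v)%:R by [].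
  have cl := @clamp_continuous t.
  by apply: cvgD; apply: cvgMl => //; apply: cvgB => //; exact: cvg_cst.
have hcont : h @ within A (nbhs (edge_point u v (clamp t))) -->
    h (edge_point u v (clamp t)).
  by move/subspace_continuousP : hc => hc; exact: (hc _ (rt t)).
have : (fun s => h (edge_point u v (clamp s))) @ t --> h (edge_point u v (clamp t)).
  move=> B /hcont nB.
  have ep : nbhs t [set s | A (edge_point u v (clamp s)) ->
                           B (h (edge_point u v (clamp s)))].
    exact: epc _ nB.
  suff : nbhs t [set s | B (h (edge_point u v (clamp s)))] by [].
  by apply: filterS ep => s; apply; exact: rt.
move=> hc'; exact: (cvg_comp _ _ hc' (@proj_continuous _ _ w _)).
Qed.

(** The homeomorphism turns an edge of [G] into an injective arc, hence into the path
of [graph_path].  Which end of the edge comes first is left open by summing over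
both. *)
Lemma subdivided_edge (hv : G -> H) (a : {set G}) :
  (forall v, h (vpoint R v) = vpoint R (hv v)) -> a \in edges G ->
  exists (x : H) (s : seq H), [/\ uniq (x :: s),
    forall F : H -> 'F_2, F x + F (last x s) = \sum_(u in a) F (hv u),
    forall e, e \in links x s -> [set e.1; e.2]%SET \in edges H &
    forall y, (exists2 z, cell a z & h z = y) <->
              exists2 e, e \in links x s & cell [set e.1; e.2]%SET y].
Proof.
move=> hvE aE; have [u [v [uv aE']]] := edge_ends aE; subst a.
have ep0 : edge_point u v 0 = vpoint R u.
  by apply/funext => w; rewrite /edge_point /vpoint; lra.
have ep1 : edge_point u v 1 = vpoint R v.
  by apply/funext => w; rewrite /edge_point /vpoint; lra.
have [[hR _ _ _] _] := hk.
pose c t := h (edge_point u v (clamp t)).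
have [||||| s [us ls es cs]] := @graph_path R H c (hv u) (hv v).
- by move=> w; exact: subdivided_arc_continuous.
- move=> t; apply: (hR _ _).1; apply: (cell_realization aE).
  exact: edge_point_cell uv (clampP t).
- move=> t t' t01 t'01; rewrite /c !clamp_id //.
  move/(subdivision_inj (cell_realization aE (edge_point_cell uv t01))
          (cell_realization aE (edge_point_cell uv t'01))).
  move/(congr1 (fun x : bary R G => x v)).
  rewrite /edge_point eqxx eq_sym (negbTE uv) /=; lra.
- by rewrite /c clamp_id ?ep0 ?hvE ?lexx ?ler01.
- by rewrite /c clamp_id ?ep1 ?hvE ?lexx ?ler01.
exists (hv u), s; split=> //.
  by move=> F; rewrite ls big_setU1 ?inE // big_set1.
move=> y; rewrite -cs; split=> [[z za <-]|[t t01 <-]].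
  have [z01 zE] := cell_edge_point uv za; exists (z v) => //.
  by rewrite /c clamp_id // -zE.
by exists (edge_point u v t); [exact: edge_point_cell|rewrite /c clamp_id].
Qed.

End Subdivision.

(** * The drawing given by a map in general position *)

Section LinksUniq.
Variables (T : finType) (x : T) (s : seq T).
Hypothesis us : uniq (x :: s).

Lemma links_uniq : uniq (links x s).
Proof.
apply: (@map_uniq _ _ snd); rewrite -/(unzip2 _) unzip2_zip //=.
by case/andP: us.
Qed.

Lemma index_links e : e \in links x s -> index e.2 (x :: s) = (index e.1 (x :: s)).+1.
Proof.
move=> /links_split[l1 [l2 E]]; move: us; rewrite E cat_uniq => /and3P[_ /hasPn no].
move=> /= /andP[]; rewrite inE negb_or => /andP[e12 _] _.
have n1 : e.1 \notin l1 by apply: no; rewrite inE eqxx.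
have n2 : e.2 \notin l1 by apply: no; rewrite !inE eqxx orbT.
by rewrite !index_cat (negbTE n1) (negbTE n2) /= !eqxx (negbTE e12) addn0 addn1.
Qed.

(** A path without repetition does not traverse an edge backwards: the second end of a
link comes right after the first one. *)
Lemma links_set_inj e e' : e \in links x s -> e' \in links x s ->
  [set e.1; e.2]%SET = [set e'.1; e'.2]%SET -> e = e'.
Proof.
move=> /index_links i /index_links i' E.
have e1 : e.1 \in [set e'.1; e'.2]%SET by rewrite -E !inE eqxx.
have e2 : e.2 \in [set e'.1; e'.2]%SET by rewrite -E !inE eqxx orbT.
have ne : e.1 <> e.2 by move=> E12; move: i; rewrite E12 => /n_Sn.
case: e e' i i' e1 e2 ne {E} => [u v] [u' v'] /= i i'; rewrite !inE.
case/orP=> /eqP Eu; case/orP=> /eqP Ev; move=> ne; subst=> //.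
by move: i; rewrite i' => /eqP; rewrite -addn2 -[X in X == _]addn0 eqn_add2l.
Qed.

End LinksUniq.

Section Collinear.
Variable R : realType.
Implicit Types p q r z : R * R.

Lemma collinearI a b d p q r : (a, b) != (0, 0) :> R * R ->
  a * p.1 + b * p.2 = d -> a * q.1 + b * q.2 = d -> a * r.1 + b * r.2 = d ->
  collinear p q r.
Proof. by move=> ab hp hq hr; exists a, b, d; split=> // s [[|]|] ->. Qed.

Lemma collinear_eq p r : collinear p p r.
Proof.
have [E|pr] := eqVneq p r.
  rewrite -E; apply: (@collinearI 1 0 p.1); rewrite ?mul1r ?mul0r ?addr0 //.
  by rewrite xpair_eqE oner_eq0.
apply: (@collinearI (r.2 - p.2) (p.1 - r.1) (r.2 * p.1 - r.1 * p.2)); [|ring..].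
apply: contra pr; rewrite xpair_eqE !subr_eq0 => /andP[/eqP h1 /eqP h2].
by case: p r h1 h2 => ? ? [? ?] /= -> ->.
Qed.

Lemma seg_collinear z p q : seg (p, q) z -> collinear z p q.
Proof.
move=> [t [_ /= z1 z2]]; have [E|pq] := eqVneq p q.
  suff -> : z = p by rewrite E; exact: collinear_eq.
  by case: z z1 z2 => ? ? /= -> ->; rewrite -E; case: p {E} => ? ?; congr pair => /=; ring.
apply: (@collinearI (q.2 - p.2) (p.1 - q.1) (q.2 * p.1 - q.1 * p.2));
  rewrite ?z1 ?z2; [|ring..].
apply: contra pq; rewrite xpair_eqE !subr_eq0 => /andP[/eqP h1 /eqP h2].
by case: p q h1 h2 {z1 z2} => ? ? [? ?] /= -> ->.
Qed.

Lemma seg_meet_unique p q r s z z' : ~ collinear p q r ->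
  seg (p, q) z -> seg (r, s) z -> seg (p, q) z' -> seg (r, s) z' -> z = z'.
Proof.
move=> npqr [t [_ /= zt1 zt2]] [u [_ /= zu1 zu2]].
move=> [t' [_ /= zt1' zt2']] [u' [_ /= zu1' zu2']].
have [E|uu] := eqVneq u u'.
  case: z z' zu1 zu2 zu1' zu2' {zt1 zt2 zt1' zt2'} => ? ? [? ?] /= -> -> -> ->.
  by rewrite E.
exfalso; apply: npqr; have [E|pq] := eqVneq p q; first by rewrite E; exact: collinear_eq.
apply: (@collinearI (q.2 - p.2) (p.1 - q.1) (q.2 * p.1 - q.1 * p.2)); [|ring|ring|].
  apply: contra pq; rewrite xpair_eqE !subr_eq0 => /andP[/eqP h1 /eqP h2].
  by case: p q h1 h2 {zt1 zt2 zt1' zt2'} => ? ? [? ?] /= -> ->.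
apply/eqP; rewrite -subr_eq0; have du : u' - u != 0 by rewrite subr_eq0 eq_sym.
rewrite -(mulrI_eq0 _ (mulfI du)).
(* [D] is affine and vanishes on the line through [p] and [q], hence at [z] and [z'] *)
pose D (x y : R) := (q.2 - p.2) * x + (p.1 - q.1) * y - (q.2 * p.1 - q.1 * p.2).
have D0 v : D ((1 - v) * p.1 + v * q.1) ((1 - v) * p.2 + v * q.2) = 0 by rewrite /D; ring.
have Ds v : D ((1 - v) * r.1 + v * s.1) ((1 - v) * r.2 + v * s.2) =
    (1 - v) * D r.1 r.2 + v * D s.1 s.2 by rewrite /D; ring.
have := Ds u; have := Ds u'.
rewrite -zu1 -zu2 -zu1' -zu2' zt1 zt2 zt1' zt2' !D0 -/(D _ _) => e1 e2.
apply/eqP; transitivity (u' * ((1 - u) * D r.1 r.2 + u * D s.1 s.2) -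
                         u * ((1 - u') * D r.1 r.2 + u' * D s.1 s.2)).
  by ring.
by rewrite -e1 -e2; ring.
Qed.

End Collinear.

Lemma card_fset_set_seq (T : choiceType) (A : set T) (s : seq T) :
  uniq s -> (forall x, A x <-> x \in s) -> #|` fset_set A| = size s.
Proof.
move=> us As; have -> : A = [set` [fset x in s]%fset].
  by apply/seteqP; split=> x /=; rewrite inE /= => /As.
by rewrite set_fsetK card_fseq undup_id.
Qed.

Lemma linear_cell (R : realType) (H : graph) (g : bary R H -> R * R) (v w : H) : v != w ->
  linear_on_edge g [set v; w]%SET ->
  g @` cell [set v; w]%SET = seg (g (vpoint R v), g (vpoint R w)).
Proof.
move=> vw lin.
have gE x : cell [set v; w]%SET x ->
    (g x).1 = x v * (g (vpoint R v)).1 + x w * (g (vpoint R w)).1 /\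
    (g x).2 = x v * (g (vpoint R v)).2 + x w * (g (vpoint R w)).2.
  by move=> /lin ->; rewrite big_setU1 ?inE // big_set1.
apply/seteqP; split=> [z [x xc <-]|z [t [t01 /= z1 z2]]].
  have [g1 g2] := gE x xc; have xs := cell_edge_sum vw xc; have [x0 _ _] := xc.
  have [xv xw] := (x0 v, x0 w).
  by exists (x w); split => /=; rewrite ?g1 ?g2; [lra|congr (_ * _ + _); lra..].
have tc := edge_point_cell vw t01; exists (edge_point v w t) => //.
have [g1 g2] := gE _ tc; apply/eqP; rewrite -pair_eqE /pair_eq g1 g2 z1 z2 /edge_point.
rewrite ![v == v]eqxx ![w == w]eqxx (eq_sym w v) (negbTE vw) /=.
by rewrite !mulr0 !mulr1 addr0 add0r !eqxx.
Qed.

(** The arcs are the images of the edge paths in the subdivision.  Disjoint edges of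
[G] become vertex-disjoint paths, so that a crossing point of their images is never
the image of a vertex; then no third edge passes through it, and it belongs to
exactly one pair of segments.  Counting points thus amounts to counting pairs of
segments that meet. *)
Lemma pl_drawing (R : realType) (G : graph) (P : {set {set G} * {set G}})
    (f : bary R G -> R * R) : pair_collection P -> pl_general_position f ->
  exists (pt : G -> R * R) (ch : {set G} -> seq ((R * R) * (R * R))),
    drawing P pt ch /\ forall p, p \in P ->
    crossings ch p = (#|` fset_set (f @` cell p.1 `&` f @` cell p.2)|)%:R.
Proof.
move=> hP [H [h [k [hk [lin ncol triple]]]]].
have [[hR _ _ _] hv0] := hk.
have [hv hvE] := choice hv0.
set g := f \o k in lin ncol triple.
pose q w := g (vpoint R w).
have edge_path (a : {set G}) : exists L : seq (H * H), a \in edges G ->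
  [/\ uniq L, {in L &, forall e e', [set e.1; e.2]%SET = [set e'.1; e'.2]%SET -> e = e'},
    forall F : H -> 'F_2, \sum_(e <- L) (F e.1 + F e.2) = \sum_(u in a) F (hv u),
    forall e, e \in L -> [set e.1; e.2]%SET \in edges H &
    forall y, (exists2 z, cell a z & h z = y) <->
              exists2 e, e \in L & cell [set e.1; e.2]%SET y].
  have [aE|] := boolP (a \in edges G); last by exists [::].
  have [x [s [us ts es cs]]] := subdivided_edge hk hvE aE.
  exists (links x s) => _; split=> //; first exact: links_uniq.
    by move=> e e'; exact: links_set_inj.
  by move=> F; rewrite sum_links.
have {edge_path} [L LP] := choice edge_path.
pose ch (a : {set G}) := [seq (q e.1, q e.2) | e <- L a].
have ne e a : a \in edges G -> e \in L a -> e.1 != e.2.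
  move=> aE eL; have [_ _ _ /(_ e eL) /edges_card] := LP a aE.
  by case: eqVneq => // ->; rewrite finset.setUid cards1.
have linseg a e : a \in edges G -> e \in L a ->
    g @` cell [set e.1; e.2]%SET = seg (q e.1, q e.2).
  move=> aE eL; apply: linear_cell; first exact: ne eL.
  by have [_ _ _ es _] := LP a aE; apply/lin/es.
have disj p e e' x : p \in P -> e \in L p.1 -> e' \in L p.2 ->
    x \in [set e.1; e.2]%SET -> x \notin [set e'.1; e'.2]%SET.
  case: p => a b pP /= ea eb xe; apply/negP => xe'.
  have [aE bE _ ab0] := hP _ _ pP.
  have [_ _ _ _ ca] := LP a aE; have [_ _ _ _ cb] := LP b bE.
  have [z za hz] : exists2 z, cell a z & h z = vpoint R x.
    by apply/ca; exists e => //; exact: vpoint_cell.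
  have [z' zb hz'] : exists2 z, cell b z & h z = vpoint R x.
    by apply/cb; exists e' => //; exact: vpoint_cell.
  have zz : z = z'.
    apply: (subdivision_inj hk); rewrite ?hz ?hz' //.
      exact: cell_realization aE za.
    exact: cell_realization bE zb.
  subst z'; have /eqP := cell_sum za.
  rewrite big1 ?(eq_sym 0) ?oner_eq0 // => v va; have [_ _ hb] := zb.
  exact/hb/(pair_disjoint hP pP va).
have off p e e' : p \in P -> e \in L p.1 -> e' \in L p.2 ->
    endpoints_off (q e.1, q e.2) (q e'.1, q e'.2).
  move=> pP ea eb; have aE : p.1 \in edges G by case: p pP {ea eb} => a b /hP[].
  have bE : p.2 \in edges G by case: p pP {ea eb aE} => a b /hP[].
  have [n1 n2] := (ne _ _ aE ea, ne _ _ bE eb).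
  have d1 := disj _ _ _ e.1 pP ea eb; have d2 := disj _ _ _ e.2 pP ea eb.
  move: d1 d2; rewrite !inE !eqxx orbT => /(_ isT) /norP[d11 d12] /(_ isT) /norP[d21 d22].
  by split=> /= /seg_collinear; apply: ncol => //; rewrite eq_sym.
exists (q \o hv), ch; split.
  split=> [a aE F|p s t pP /mapP[e ea ->] /mapP[e' eb ->]|p u v pP up vp].
  - have [_ _ sumL _ _] := LP a aE.
    by rewrite big_map (sumL (F \o q)).
  - exact: off eb.
  (* two vertices with the same image are collinear with any third one *)
  - have aE : p.1 \in edges G by case: p pP {up vp} => a b /hP[].
    have [u' u'p uu'] : exists2 u', u' \in p.1 & u' != u.
      have [x [y [xy E]]] := edge_ends aE.
      move: up; rewrite E !inE => /orP[] /eqP ->.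
        by exists y; rewrite ?inE ?eqxx ?orbT // eq_sym.
      by exists x; rewrite ?inE ?eqxx.
    have hv_inj x y : x != y -> hv x != hv y.
      apply: contra => /eqP E; apply/eqP/(@vpoint_inj R G)/(subdivision_inj hk);
        [exact: vpoint_realization..|by rewrite !hvE E].
    have nv x : x \in p.1 -> x != v.
      by move=> xp; apply: contraTneq vp => <-; exact: pair_disjoint hP pP xp.
    apply/eqP => /= E; apply: (ncol (hv u) (hv v) (hv u')).
    - by apply: hv_inj; exact: nv.
    - by rewrite eq_sym; apply: hv_inj; exact: nv.
    - by rewrite eq_sym; apply: hv_inj.
    by rewrite -/(q _) -/(q (hv v)) E; exact: collinear_eq.
case=> a b pP /=; have [aE bE _ _] := hP _ _ pP.
have [ua ia _ ea ca] := LP a aE; have [ub ib _ eb cb] := LP b bE.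
have fk c x : c \in edges G -> cell c x -> g (h x) = f x.
  by move=> cE xc; rewrite /g /= (hR _ (cell_realization cE xc)).2.
have fcell c y : c \in edges G ->
    (f @` cell c) y <-> exists2 e, e \in L c & seg (q e.1, q e.2) y.
  move=> cE; have [_ _ _ _ cc] := LP c cE; split=> [[x xc <-]|[e ec]].
    have [e el hx] : exists2 e, e \in L c & cell [set e.1; e.2]%SET (h x).
      by apply/cc; exists x.
    by exists e => //; rewrite -(linseg _ _ cE el); exists (h x) => //; exact: fk cE xc.
  rewrite -(linseg _ _ cE ec) => -[y' y'e <-].
  have [x xc <-] : exists2 z, cell c z & h z = y' by apply/cc; exists e.
  by exists x => //; rewrite (fk _ _ cE).
pose X := [seq x <- [seq (e, e') | e <- L a, e' <- L b] |
              meets (q x.1.1, q x.1.2) (q x.2.1, q x.2.2)].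
pose pnt (x : (H * H) * (H * H)) : R * R :=
  xget 0 (seg (q x.1.1, q x.1.2) `&` seg (q x.2.1, q x.2.2)).
have pntP x : x \in X -> [/\ x.1 \in L a, x.2 \in L b,
    seg (q x.1.1, q x.1.2) (pnt x) & seg (q x.2.1, q x.2.2) (pnt x)].
  rewrite mem_filter => /andP[/asboolP/(xgetPex 0)[sa sb] /allpairsP[[e e'] [el e'l E]]].
  by split; rewrite // E.
have pnt_vertex x w : x \in X -> pnt x <> q w.
  move=> /pntP[xa xb sa sb] E.
  have inside c e : c \in edges G -> e \in L c -> seg (q e.1, q e.2) (q w) ->
      w \in [set e.1; e.2]%SET.
    move=> cE ec /seg_collinear col; apply: contraPT col.
    by rewrite !inE negb_or => /andP[w1 w2]; apply: ncol => //; exact: ne ec.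
  rewrite E in sa sb.
  have := disj (a, b) _ _ w pP xa xb (inside _ _ aE xa sa).
  by rewrite (inside _ _ bE xb sb).
have pnt_inj : {in X &, injective pnt}.
  move=> x y xX yX xy; have [xa xb sxa sxb] := pntP x xX; have [ya yb sya syb] := pntP y yX.
  have mixed e e' : e \in L a -> e' \in L b -> [set e.1; e.2]%SET != [set e'.1; e'.2]%SET.
    move=> el e'l; apply/eqP => E; have := disj (a, b) e e' e.1 pP el e'l.
    by rewrite -E !inE eqxx => /(_ isT).
  have E1 : x.1 = y.1.
    apply: ia => //; apply/eqP/negPn/negP => n.
    have n' := mixed _ _ ya xb; have n'' := mixed _ _ xa xb.
    have [] := triple _ _ _ (ea _ xa) (ea _ ya) (eb _ xb) n n' n'' (pnt x).
    - by rewrite (linseg _ _ aE xa).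
    - by rewrite (linseg _ _ aE ya) xy.
    - by rewrite (linseg _ _ bE xb).
    by move=> w; exact: pnt_vertex.
  have E2 : x.2 = y.2.
    apply: ib => //; apply/eqP/negPn/negP => n.
    have n' := mixed _ _ xa xb; have n'' := mixed _ _ xa yb.
    have [] := triple _ _ _ (ea _ xa) (eb _ xb) (eb _ yb) n' n n'' (pnt x).
    - by rewrite (linseg _ _ aE xa).
    - by rewrite (linseg _ _ bE xb).
    - by rewrite (linseg _ _ bE yb) xy.
    by move=> w; exact: pnt_vertex.
  by case: x y E1 E2 {xX yX xy xa xb sxa sxb ya yb sya syb} => ? ? [? ?] /= -> ->.
rewrite (@card_fset_set_seq _ _ (map pnt X)); first last.
- move=> z; split.
    move=> [/(fcell _ _ aE)[e el se] /(fcell _ _ bE)[e' e'l se']].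
    have xX : (e, e') \in X.
      by rewrite mem_filter /= allpairs_f // andbT; apply/asboolP; exists z.
    apply/mapP; exists (e, e') => //; have [_ _ s1 s2] := pntP _ xX.
    apply: seg_meet_unique se se' s1 s2; apply: ncol; first exact: ne el.
      have := disj (a, b) e e' e.2 pP el e'l.
      by rewrite !inE eqxx orbT => /(_ isT) /norP[].
    have := disj (a, b) e e' e.1 pP el e'l.
    by rewrite !inE eqxx => /(_ isT) /norP[].
  move=> /mapP[x /pntP[xa xb sa sb] ->]; split.
    by apply/(fcell _ _ aE); exists x.1.
  by apply/(fcell _ _ bE); exists x.2.
- by rewrite map_inj_in_uniq // filter_uniq // allpairs_uniq // => -[? ?] [? ?].
rewrite size_map size_filter -sum1_count natr_sum /crossings big_map.
rewrite [RHS]big_mkcond big_allpairs /=; apply: eq_bigr => e _.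
by rewrite big_map; apply: eq_bigr => e' _; case: ifP.
Qed.

(** * The drawing given by a string representation *)

Lemma links_rcons (T : Type) (x : T) s y :
  links x (rcons s y) = rcons (links x s) (last x s, y).
Proof. by elim: s x => //= z s IH x; rewrite -IH. Qed.

Section Curves.
Variable R : realType.
Implicit Types (A B : set (R * R)) (x y z : R * R).

(** The points that can be reached from [x] by steps shorter than [e] form a clopen
part of [A]. *)
Lemma connected_chain A e x y : connected A -> 0 < e -> A x -> A y ->
  exists s, last x s = y /\ forall l, l \in links x s -> A l.1 /\ ball l.1 e l.2.
Proof.
move=> cA e0 Ax Ay.
pose reach y := exists s, last x s = y /\
  forall l, l \in links x s -> A l.1 /\ ball l.1 e l.2.
suff : A `&` reach = A by move=> E; have [] : (A `&` reach) y by rewrite E.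
have step y1 y2 : A y1 -> reach y1 -> ball y1 e y2 -> reach y2.
  move=> Ay1 [s [ls hs]] y12; exists (rcons s y2); rewrite last_rcons; split=> // l.
  by rewrite links_rcons mem_rcons inE => /orP[/eqP ->|/hs //] /=; rewrite ls.
apply: cA.
- by exists x; split => //; exists [::].
- exists (\bigcup_(z in A `&` reach) ball z e).
    by apply: bigcup_open => z _; exact: ball_open.
  apply/seteqP; split=> z [Az].
    by move=> rz; split=> //; exists z => //; exact: ballxx.
  by move=> [z' [Az' rz'] zz']; split=> //; exact: step zz'.
- exists (~` \bigcup_(z in A `\` reach) ball z e).
    by apply/open_closedC/bigcup_open => z _; exact: ball_open.
  apply/seteqP; split=> z [Az].
    move=> rz; split=> // -[z' [Az' nrz'] z'z]; apply: nrz'.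
    by apply: step rz _ => //; exact: ball_sym.
  move=> nz; split=> //; apply: contrapT => nrz; apply: nz.
  by exists z => //; exact: ballxx.
Qed.

Lemma seg_ball (l : (R * R) * (R * R)) e z : ball l.1 e l.2 -> seg l z -> ball l.1 e z.
Proof.
move=> [b1 b2] [a [/andP[a0 a1] z1 z2]].
have bd (u v w : R) : w = (1 - a) * u + a * v -> ball u e v -> ball u e w.
  rewrite /ball /= => -> uv.
  have -> : u - ((1 - a) * u + a * v) = a * (u - v) by ring.
  rewrite normrM (ger0_norm a0); apply: le_lt_trans uv.
  by rewrite ler_piMl.
by split; [exact: bd z1 b1|exact: bd z2 b2].
Qed.

Lemma curve_connected A : curve A -> connected A.
Proof.
move=> [c cc ->]; apply: connected_continuous_connected => //.
exact: segment_connected.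
Qed.

Lemma curve_compact A : curve A -> compact A.
Proof. by move=> [c cc ->]; apply: continuous_compact => //; exact: segment_compact. Qed.

Lemma curve_nonempty A : curve A -> A !=set0.
Proof. by move=> [c _ ->]; exists (c 0); exists 0 => //=; rewrite in_itv /= lexx ler01. Qed.

(** Every point of [A] has a positive distance to the closed set [B], and this distance
is bounded below in a neighbourhood of the point; [A] is covered by finitely many. *)
Lemma compact_apart A B : compact A -> compact B -> A `&` B = set0 ->
  \forall d \near 0^'+, forall x, A x -> forall y, B y -> ~ ball x d y.
Proof.
move=> /compact_near_coveringP cA cB AB.
have clB : closed B by apply: compact_closed cB; exact: norm_hausdorff.
apply: (cA R (0^'+) (fun d x => forall y, B y -> ~ ball x d y)) => x Ax.
have nBx : ~ B x by move=> Bx; have : (A `&` B) x by []; rewrite AB.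
have [r [r0 rB]] : exists r : R, 0 < r /\ closed_ball x r `&` B = set0.
  have := filter_ex (filterI (closed_disjoint_closed_ball clB nBx) (nbhs_right_gt (0 : R))).
  by case=> r [? ?]; exists r.
exists (ball x (r / 2), [set d | d < r / 2]) => [|[x' d] /= [xx' dr] y By x'y].
  by split => /=; [apply: nbhsx_ballx; lra|apply: nbhs_right_lt; lra].
suff : (closed_ball x r `&` B) y by rewrite rB.
split=> //; apply: subset_closed_ball; rewrite [r]splitr.
by apply: ball_triangle xx' _; apply: le_ball x'y; exact: ltW.
Qed.

End Curves.

Section StringDrawing.
Variables (R : realType) (G : graph).

(** Choose [e] so small that the [e]-neighbourhoods of the curves of distinct
non-adjacent vertices are disjoint.  For an edge uv go from a point of the curve of
[u] to a common point of both curves, and on to a point of the curve of [v], by steps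
shorter than [e]: the arc stays in the [e]-neighbourhood of the two curves, so the
arcs of a pair of string edges are disjoint. *)
Lemma string_drawing : string_graph R G ->
  exists (pt : G -> R * R) (ch : {set G} -> seq ((R * R) * (R * R))),
    drawing (string_pairs G) pt ch /\
    forall p, p \in string_pairs G -> crossings ch p = 0.
Proof.
move=> [gam gamC gamI].
have apart v w : \forall d \near (0 : R)^'+,
    v != w -> ~~ adj v w -> forall x y, gam v x -> gam w y -> ~ ball x d y.
  have [vw|nvw] := boolP ((v != w) && ~~ adj v w); last first.
    by apply: nearW => d vw nadj; move: nvw; rewrite vw nadj.
  move: vw => /andP[vw nadj].
  have : gam v `&` gam w = set0.
    apply/seteqP; split=> // x gx; have : adj v w by apply/(gamI v w vw); exists x.
    by rewrite (negbTE nadj).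
  move=> /(compact_apart (curve_compact (gamC v)) (curve_compact (gamC w))).
  by apply: filterS => d dP _ _ x y /dP; apply.
have [e [e0 eP]] : exists e : R, 0 < e /\ forall v w x y z, v != w -> ~~ adj v w ->
    gam v x -> gam w y -> ball x e z -> ~ ball y e z.
  have [d [d0 dP]] := filter_ex (filterI (nbhs_right_gt (0 : R))
    (filter_forall _ (fun v => filter_forall _ (apart v)))).
  exists (d / 2); split; first lra.
  move=> v w x y z vw nadj vx wy xz yz; apply: (dP v w vw nadj x y vx wy).
  by rewrite [d]splitr; apply: ball_triangle xz _; exact: ball_sym.
have [pt ptP] := choice (fun v => curve_nonempty (gamC v)).
have edge_chain (a : {set G}) : exists L : seq ((R * R) * (R * R)), a \in edges G ->
    (forall F : R * R -> 'F_2, \sum_(l <- L) (F l.1 + F l.2) = \sum_(u in a) F (pt u)) /\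
    forall l, l \in L -> exists v x, [/\ v \in a, gam v x & seg l `<=` ball x e].
  have [aE|] := boolP (a \in edges G); last by exists [::].
  have [u [v [uv aE']]] := edge_ends aE; subst a.
  have [z [uz vz]] : gam u `&` gam v !=set0 by apply/(gamI u v uv).
  have [s [ls hs]] := connected_chain (curve_connected (gamC u)) e0 (ptP u) uz.
  have [s' [ls' hs']] := connected_chain (curve_connected (gamC v)) e0 vz (ptP v).
  exists (links (pt u) s ++ links z s') => _; split.
    move=> F; rewrite big_cat !sum_links ls ls' /= big_setU1 ?inE // big_set1.
    by rewrite addrA -[_ + F z + F z]addrA addF2 addr0.
  move=> l; rewrite mem_cat => /orP[/hs|/hs'] [g1 g2].
    by exists u, l.1; split=> //; [rewrite !inE eqxx|move=> y; exact: seg_ball].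
  by exists v, l.1; split=> //; [rewrite !inE eqxx orbT|move=> y; exact: seg_ball].
have [ch chP] := choice edge_chain.
have pairP p u v : p \in string_pairs G -> u \in p.1 -> v \in p.2 -> u != v /\ ~~ adj u v.
  move=> pP up vp; split.
    by apply: contraTneq vp => <-; exact: pair_disjoint (@string_pairs_collection G) pP up.
  move: pP; rewrite inE => /and3P[_ _ /forall_inP/(_ u up)/forall_inP/(_ v vp)].
  exact.
have disj p s t z : p \in string_pairs G -> s \in ch p.1 -> t \in ch p.2 ->
    seg s z -> ~ seg t z.
  move=> pP sa tb sz tz.
  have [aE bE] : p.1 \in edges G /\ p.2 \in edges G by move: pP; rewrite inE => /and3P[].
  have [u [x [ua ux sx]]] := (chP _ aE).2 s sa.
  have [v [y [vb vy ty]]] := (chP _ bE).2 t tb.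
  have [uv nadj] := pairP _ _ _ pP ua vb.
  exact: eP uv nadj ux vy (sx _ sz) (ty _ tz).
exists pt, ch; split.
  split=> [a aE F|p s t pP sa tb|p u v pP up vp].
  - exact: (chP _ aE).1.
  - have := disj _ _ _ _ pP sa tb.
    split=> h; [exact: H (seg_left s) h|exact: H (seg_right s) h|
                exact: H h (seg_left t)|exact: H h (seg_right t)].
  - have [uv nadj] := pairP _ _ _ pP up vp.
    apply/eqP => E; have : adj u v; last by rewrite (negbTE nadj).
    by apply/(gamI u v uv); exists (pt u); split; rewrite // E.
move=> p pP; rewrite /crossings big_seq big1 // => s sa.
rewrite big_seq big1 // => t tb; have -> // : meets s t = false.
by apply/asboolP => -[z [sz tz]]; exact: disj pP sa tb sz tz.
Qed.

End StringDrawing.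

(** * Existence of a map in general position *)

Section Abscissae.
Variable R : realFieldType.
Implicit Types (a b c d e f x : R) (l : seq R).

(** The chord of the parabola over [a] and [b] is the line y = (a + b) x - ab.  This
determinant vanishes when the chords over [a, b], over [c, d] and over [e, f] have a
common point. *)
Definition concurrence a b c d e f :=
  ((c + d) - (a + b)) * (e * f - a * b) - ((e + f) - (a + b)) * (c * d - a * b).

Definition generic l := forall a b c d e f,
  {subset [:: a; b; c; d; e; f] <= l} -> uniq [:: a; b; c; d; e; f] ->
  concurrence a b c d e f != 0.

Let slope a b c d e := ((c + d) - (a + b)) * e - (c * d - a * b).

(** The root of [concurrence a b c d e], which is affine in its last argument with
leading coefficient [slope]. *)
Let bad a b c d e :=
  (((c + d) - (a + b)) * (a * b) + (e - (a + b)) * (c * d - a * b)) / slope a b c d e.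

(** If the leading coefficient vanishes, then so does the constant term only if the line
of the first chord meets the parabola in a third point: over [e], or over [c] when the
first two chords are parallel. *)
Lemma concurrence_last a b c d e x : uniq [:: a; b; c; d; e] -> x != bad a b c d e ->
  concurrence a b c d e x != 0.
Proof.
rewrite /= !inE !negb_or => /and5P[/and4P[ab ac ad ae] /and3P[bc bd be] /andP[cd ce] de _] xbad.
have [K0|K0] := eqVneq (slope a b c d e) 0; last first.
  apply: contraNneq xbad => C0; apply/eqP/(mulIf K0); rewrite divfK //.
  by move: C0; rewrite /concurrence /slope; lra.
have E : c * d - a * b = ((c + d) - (a + b)) * e by move: K0; rewrite /slope; lra.
have -> : concurrence a b c d e x = - ((c + d) - (a + b)) * ((e - a) * (e - b)).
  by rewrite /concurrence E; ring.
rewrite !mulf_eq0 oppr_eq0 !subr_eq0 !negb_or ![e == _]eq_sym ae be !andbT.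
apply/negP => /eqP s12.
have : (c - a) * (c - b) = 0.
  have cd_ab : c * d = a * b by apply/eqP; rewrite -subr_eq0 E s12 subrr mul0r.
  transitivity (c * (c + d - (a + b)) - (c * d - a * b)); first by ring.
  by rewrite cd_ab s12 !subrr mulr0 subr0.
by move/eqP; rewrite mulf_eq0 !subr_eq0 ![c == _]eq_sym (negbTE ac) (negbTE bc).
Qed.

(** By the symmetry of [concurrence] the new abscissa may be taken to be its last
argument. *)
Lemma generic_cons l : uniq l -> generic l ->
  exists x, uniq (x :: l) /\ generic (x :: l).
Proof.
move=> ul gl.
pose l2 := [seq (a, b) | a <- l, b <- l].
have [x] := notin_seq (l ++ [seq bad u.1 u.2 v.1.1 v.1.2 v.2 |
                              u <- l2, v <- [seq (w, e) | w <- l2, e <- l]]).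
rewrite mem_cat negb_or => /andP[xl xbad].
have conc_x a b c d e : {subset [:: a; b; c; d; e] <= l} -> uniq [:: a; b; c; d; e] ->
    concurrence a b c d e x != 0.
  move=> sl us; apply: concurrence_last => //; apply: contraNneq xbad => ->.
  apply/allpairsP; exists ((a, b), ((c, d), e)).
  by split=> //; do ?[apply: allpairs_f]; apply: sl; rewrite !inE eqxx ?orbT.
exists x; split; first by rewrite /= xl.
move=> a b c d e f sl us.
have [xs|xs] := boolP (x \in [:: a; b; c; d; e; f]); last first.
  apply: gl => // y ys; have := sl y ys; rewrite inE => /orP[/eqP yx|//].
  by rewrite -yx ys in xs.
have sub y : y \in [:: a; b; c; d; e; f] -> y != x -> y \in l.
  by move=> /sl; rewrite inE => /orP[->|].
have key a' b' c' d' e' : perm_eq [:: a'; b'; c'; d'; e'; x] [:: a; b; c; d; e; f] ->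
    concurrence a' b' c' d' e' x != 0.
  move=> pe; have us' : uniq [:: a'; b'; c'; d'; e'; x] by rewrite (perm_uniq pe).
  have : uniq (rcons [:: a'; b'; c'; d'; e'] x) by [].
  rewrite rcons_uniq => /andP[xn un]; apply: conc_x => // y ys; apply: sub.
    rewrite -(perm_mem pe) -[_ :: _]/(rcons [:: a'; b'; c'; d'; e'] x).
    by rewrite mem_rcons inE ys orbT.
  by apply: contraNneq xn => <-.
have swap a' b' c' d' e' :
    concurrence a' b' c' d' e' x = concurrence a b c d e f ->
    perm_eq [:: a'; b'; c'; d'; e'; x] [:: a; b; c; d; e; f] ->
    concurrence a b c d e f != 0.
  by move=> <- /key.
move: xs; rewrite !inE => /or4P[/eqP E|/eqP E|/eqP E|/or3P[/eqP E|/eqP E|/eqP E]].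
- by apply: (swap c d e f b); [|apply/permP => p /=]; rewrite E ?/concurrence; ring.
- by apply: (swap c d e f a); [|apply/permP => p /=]; rewrite E ?/concurrence; ring.
- by apply: (swap e f a b d); [|apply/permP => p /=]; rewrite E ?/concurrence; ring.
- by apply: (swap e f a b c); [|apply/permP => p /=]; rewrite E ?/concurrence; ring.
- by apply: (swap a b c d f); [|apply/permP => p /=]; rewrite E ?/concurrence; ring.
- by apply: (swap a b c d e); rewrite E.
Qed.

Lemma generic_abscissae n : exists l, [/\ size l = n, uniq l & generic l].
Proof.
elim: n => [|n [l [ls lu lg]]]; last first.
  by have [x [xu xg]] := generic_cons lu lg; exists (x :: l); rewrite /= ls.
by exists [::]; split=> // a b c d e f /(_ a); rewrite inE eqxx => /(_ isT).
Qed.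

Lemma generic_points (T : finType) : exists t : T -> R, injective t /\
  forall a b c d e f : T, uniq [:: a; b; c; d; e; f] ->
    concurrence (t a) (t b) (t c) (t d) (t e) (t f) != 0.
Proof.
have [l [ls lu lg]] := generic_abscissae #|T|.
pose t (v : T) : R := nth 0 l (enum_rank v).
have tl v : t v \in l by rewrite mem_nth // ls.
have tinj : injective t.
  move=> v w /eqP; rewrite nth_uniq ?ls // => /eqP vw.
  by apply/enum_rank_inj/val_inj.
exists t; split=> // a b c d e f us; apply: lg => [x|].
  by rewrite -[[:: _; _; _; _; _; _]]/(map t [:: a; b; c; d; e; f]) => /mapP[v _ ->].
by rewrite -[[:: _; _; _; _; _; _]]/(map t [:: a; b; c; d; e; f]) map_inj_uniq.
Qed.

End Abscissae.

Section Existence.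
Variables (R : realType) (G : graph).

(** Draw [G] with straight edges and its vertices on a parabola: no three points of a
parabola are collinear, and generic abscissae prevent concurrent chords. *)
Lemma pl_general_position_exists : exists f : bary R G -> R * R, pl_general_position f.
Proof.
have [t [tinj tgen]] := @generic_points R G.
pose q v : R * R := (t v, t v ^+ 2).
pose f (x : bary R G) : R * R := \sum_v x v *: q v.
have fv v : f (vpoint R v) = q v.
  rewrite /f (bigD1 v) //= /vpoint eqxx scale1r big1 ?addr0 // => w /negbTE ->.
  by rewrite scale0r.
exists f, G, id, id; split.
  split; last by move=> v; exists v.
  by split=> //; apply: continuous_subspaceT => x; exact: cvg_id.
have lin e : linear_on_edge (f \o id) e.
  move=> x [_ _ xe]; rewrite /= {1}/f (bigID (mem e)) /= [X in _ + X]big1 ?addr0.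
    by apply: eq_bigr => v _; rewrite fv.
  by move=> v /xe ->; rewrite scale0r.
have chord e v w p : v != w -> e = [set v; w]%SET -> ((f \o id) @` cell e) p ->
    p.2 = (t v + t w) * p.1 - t v * t w.
  move=> vw ->; rewrite linear_cell //= !fv => -[a [_ /= -> ->]].
  by ring.
have other (e : {set G}) v : e \in edges G -> v \in e ->
    exists w, w != v /\ e = [set v; w]%SET.
  move=> /edge_ends[a [b [ab ->]]]; rewrite !inE => /orP[] /eqP ->.
    by exists b; rewrite eq_sym.
  by exists a; rewrite finset.setUC.
have shared e e' v p : e \in edges G -> e' \in edges G -> e != e' ->
    v \in e -> v \in e' -> ((f \o id) @` cell e) p -> ((f \o id) @` cell e') p ->
    exists v, p = (f \o id) (vpoint R v).
  move=> eE e'E ee' ve ve' pe pe'; exists v; rewrite /= fv.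
  have [w [wv ew]] := other _ _ eE ve; have [w' [w'v ew']] := other _ _ e'E ve'.
  have p2 := chord _ _ _ _ _ ew pe; rewrite eq_sym wv in p2.
  have p2' := chord _ _ _ _ _ ew' pe'; rewrite eq_sym w'v in p2'.
  have ww : t w - t w' != 0.
    rewrite subr_eq0; apply: contra ee' => /eqP/tinj E; by rewrite ew ew' E.
  have p1 : p.1 = t v.
    apply: (mulfI ww); have := p2 isT; rewrite p2' //; lra.
  by apply/eqP; rewrite -pair_eqE /pair_eq /= p1 p2 // p1 eqxx /=; apply/eqP; ring.
split=> [e _|u v w uv vw uw|a b c aE bE cE ab bc ac p pa pb pc]; first exact: lin.
  rewrite /= !fv => -[a [b [c [ab0 col]]]].
  have [cu [cv cw]] : [/\ a * t u + b * t u ^+ 2 = c, a * t v + b * t v ^+ 2 = c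
      & a * t w + b * t w ^+ 2 = c].
    split; [apply: (col (q u))|apply: (col (q v))|apply: (col (q w))].
    - by left; left.
    - by left; right.
    - by right.
  have zero x y z : x != y -> (t x - t y) * z = 0 -> z = 0.
    by move=> xy /eqP; rewrite mulf_eq0 subr_eq0 (inj_eq tinj) (negbTE xy) => /eqP.
  have huv : a + b * (t u + t v) = 0 by apply: (zero u v) => //; lra.
  have huw : a + b * (t u + t w) = 0 by apply: (zero u w) => //; lra.
  have b0 : b = 0 by apply: (zero v w) => //; lra.
  have a0 : a = 0 by move: huv; rewrite b0; lra.
  by move: ab0; rewrite a0 b0 eqxx.
have [/existsP[v /andP[va vb]]|nab] := boolP [exists v, (v \in a) && (v \in b)].
  exact: shared ab va vb pa pb.
have [/existsP[v /andP[vb vc]]|nbc] := boolP [exists v, (v \in b) && (v \in c)].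
  exact: shared bc vb vc pb pc.
have [/existsP[v /andP[va vc]]|nac] := boolP [exists v, (v \in a) && (v \in c)].
  exact: shared ac va vc pa pc.
have [a1 [a2 [a12 aE']]] := edge_ends aE; have [b1 [b2 [b12 bE']]] := edge_ends bE.
have [c1 [c2 [c12 cE']]] := edge_ends cE.
have us : uniq [:: a1; a2; b1; b2; c1; c2].
  have avoid (d e : {set G}) x y : ~~ [exists v, (v \in d) && (v \in e)] ->
      x \in d -> y \in e -> x != y.
    rewrite negb_exists => /forallP no xd ye; apply: contraTneq xd => ->.
    by move: (no y); rewrite ye andbT.
  have [a1a a2a] : a1 \in a /\ a2 \in a by rewrite aE' !inE !eqxx orbT.
  have [b1b b2b] : b1 \in b /\ b2 \in b by rewrite bE' !inE !eqxx orbT.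
  have [c1c c2c] : c1 \in c /\ c2 \in c by rewrite cE' !inE !eqxx orbT.
  by rewrite /= !inE !negb_or a12 b12 c12
    (avoid _ _ a1 b1 nab) // (avoid _ _ a1 b2 nab) //
    (avoid _ _ a2 b1 nab) // (avoid _ _ a2 b2 nab) //
    (avoid _ _ a1 c1 nac) // (avoid _ _ a1 c2 nac) //
    (avoid _ _ a2 c1 nac) // (avoid _ _ a2 c2 nac) //
    (avoid _ _ b1 c1 nbc) // (avoid _ _ b1 c2 nbc) //
    (avoid _ _ b2 c1 nbc) // (avoid _ _ b2 c2 nbc).
have := tgen _ _ _ _ _ _ us.
have e1 := chord _ _ _ _ a12 aE' pa; have e2 := chord _ _ _ _ b12 bE' pb.
have e3 := chord _ _ _ _ c12 cE' pc.
suff -> : concurrence (t a1) (t a2) (t b1) (t b2) (t c1) (t c2) = 0 by rewrite eqxx.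
have h2 : t b1 * t b2 - t a1 * t a2 = (t b1 + t b2 - (t a1 + t a2)) * p.1 by lra.
have h3 : t c1 * t c2 - t a1 * t a2 = (t c1 + t c2 - (t a1 + t a2)) * p.1 by lra.
by rewrite /concurrence h2 h3; ring.
Qed.

End Existence.

(** * The string obstruction *)

Theorem theorem3p2 (R : realType) (G : graph) :
  string_graph R G -> string_obstruction_vanishes R G.
Proof.
move=> /string_drawing[pt0 [ch0 [drawing0 crossings0]]].
have hP := @string_pairs_collection G.
have in_span (f : bary R G -> R * R) : pl_general_position f ->
    crossing_vec (string_pairs G) f \in <<Phi (string_pairs G)>>%VS.
  move=> /(pl_drawing hP)[pt [ch [drawing1 crossingsE]]].
  have [A AE] := crossings_invariant hP drawing1 drawing0.
  suff -> : crossing_vec (string_pairs G) f = [ffun p => finger A (val p)].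
    exact: finger_span.
  apply/ffunP => p; rewrite !ffunE -crossingsE ?AE ?crossings0 ?add0r //; exact: valP.
apply/seteqP; split=> x; rewrite /class_of /= /equiv_vec subr0.
  move=> [f /in_span fspan] xf.
  by rewrite -[x](subrK (crossing_vec (string_pairs G) f)) memvD.
have [f fP] := pl_general_position_exists R G.
by move=> xspan; exists f; rewrite // /class_of /= /equiv_vec memvB // in_span.
Qed.
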